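(* Let $G$ be a group hyperbolic relative to a collection of subgroups $\{H_\lambda\}_{\lambda\in\Lambda}$, let $X$ be a finite relative generating set, let $\mathcal H=\bigsqcup_{\lambda\in\Lambda}(H_\lambda\setminus\{1\})$, and let $\Omega=\bigcup_{\lambda}\Omega_\lambda$ be the finite subset of $G$ fixed in the context. For each $\mu\ge1$, $c\ge0$, $k\ge0$, there exists $\epsilon=\epsilon(\mu,c,k)>0$ with the following property. For any two $k$-similar $(\mu,c)$-quasi-geodesics without backtracking $p$ and $q$ in $\Gamma(G,X\cup\mathcal H)$, the following conditions hold. (1) The sets of phase vertices of $p$ and $q$ are contained in the closed $\epsilon$-neighborhoods of each other with respect to the metric $\mathsf{dist}_{X\cup\Omega}$. (2) If $s$ is an $H_\lambda$-component of $p$ such that $\mathsf{dist}_{X\cup\Omega}(s_-,s_+)\ge\epsilon$, then there exists an $H_\lambda$-component $t$ of $q$ which is connected to $s$. (3) If $s$ and $t$ are connected $H_\lambda$-components of $p$ and $q$ respectively, then $\max\{\mathsf{dist}_{X\cup\Omega}(s_-,t_-),\mathsf{dist}_{X\cup\Omega}(s_+,t_+)\}\le\epsilon$.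
   Context: Relative hyperbolicity. A subset $X\subset G$ closed under inverses is a relative generating set if $X\cup\bigcup_\lambda H_\lambda$ generates $G$. Then $G$ is a quotient of $F=(\ast_\lambda H_\lambda)\ast F(X)$; if the kernel is the normal closure of $\mathcal R\subset F$, $\langle X,H_\lambda,\lambda\in\Lambda\mid\mathcal R\rangle$ is a relative presentation, finite if $X,\mathcal R$ are finite. For a word $W$ in the alphabet $X\cup\mathcal H$ (disjoint union) representing $1$ in $G$, $\mathrm{Area}^{rel}(W)$ is the least $k$ with $W=_F\prod_{i=1}^kf_i^{-1}R_i^{\pm1}f_i$, $R_i\in\mathcal R$, $f_i\in F$. $G$ is hyperbolic relative to $\{H_\lambda\}$ if some finite relative presentation has $\mathrm{Area}^{rel}(W)$ bounded by a linear function of the length $\|W\|$. Paths. $\Gamma(G,X\cup\mathcal H)$ is the Cayley graph with vertex set $G$ and a labelled edge from $g$ to $gs$ for each $g\in G$ and each letter $s\in X\cup\mathcal H$. For a combinatorial path $p$, $p_-$ and $p_+$ are its initial and terminal vertices and $\ell(p)$ its length. An $H_\lambda$-component of a path $q$ is a maximal non-trivial subpath all of whose edges are labelled by letters of $H_\lambda\setminus\{1\}$; an $\mathcal H$-component is an $H_\lambda$-component for some $\lambda$. Two $H_\lambda$-components are connected if their vertices all lie in the same left coset of $H_\lambda$. An $H_\lambda$-component of $q$ is isolated if it is not connected to a different $H_\lambda$-component of $q$. A vertex of $q$ is phase if it is not an interior vertex of an $\mathcal H$-component of $q$. A path is without backtracking if all its $\mathcal H$-components are isolated. A path $q$ is a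 $(\mu,c)$-quasi-geodesic if every subpath $p$ satisfies $\ell(p)\le\mu\,\mathsf{dist}_{X\cup\mathcal H}(p_-,p_+)+c$, where $\mathsf{dist}_{X\cup\mathcal H}$ is the graph metric. For $Y\subset G$, $\mathsf{dist}_Y(g,h)=|g^{-1}h|_Y$, where $|g|_Y$ is word length with respect to $Y$ if $g\in\langle Y\rangle$ and $\infty$ otherwise. Paths $p,q$ are $k$-similar if $\max\{\mathsf{dist}_X(p_-,q_-),\mathsf{dist}_X(p_+,q_+)\}\le k$. The set $\Omega$ (known lemma of Osin). There exist a constant $M>0$ and subsets $\Omega_\lambda\subset H_\lambda$ such that $\Omega=\bigcup_\lambda\Omega_\lambda$ is finite and: if $q$ is a cycle in $\Gamma(G,X\cup\mathcal H)$, $p_1,\dots,p_k$ are isolated $H_\lambda$-components of $q$ for some $\lambda$, and $g_1,\dots,g_k\in G$ are represented by their labels, then $g_i\in\langle\Omega_\lambda\rangle$ for all $i$ and $\sum_{i=1}^k|g_i|_{\Omega_\lambda}\le M\ell(q)$. Such $M$ and $\Omega_\lambda$ are fixed. *)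

(* Defs.v *)
From mathcomp Require Import all_boot all_order all_algebra.
From mathcomp Require Import boolp classical_sets functions cardinality.
From mathcomp Require Import reals constructive_ereal ereal.

Set Implicit Arguments.
Unset Strict Implicit.
Unset Printing Implicit Defensive.

Import Order.TTheory GRing.Theory Num.Theory.

Local Open Scope classical_set_scope.
Local Open Scope group_scope.

Section WordMetric.
Variables (R : realType) (G : groupType).

Definition is_subgroup (S : set G) : Prop := group_closed [in S].

Definition generated (Y : set G) : set G := smallest is_subgroup Y.

Definition words_for (Y : set G) (g : G) : set (seq G) :=
  [set w | (forall y, y \in w -> Y y \/ Y y^-1) /\ \prod_(y <- w) y = g].

(* The infimum of a nonempty set of natural numbers is attained, and
   ereal_inf set0 = +oo: the length is +oo exactly outside of <Y>. *)
Definition word_length (Y : set G) (g : G) : \bar R :=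
  ereal_inf [set ((size w)%:R%:E)%E | w in words_for Y g].

Definition word_dist (Y : set G) (g h : G) : \bar R := word_length Y (g^-1 * h).

Definition nbhd_closed (Y : set G) (eps : R) (S : set G) : set G :=
  [set g | exists2 h, S h & (word_dist Y g h <= eps%:E)%E].

End WordMetric.

Section RelativePresentation.
Variables (G : groupType) (L : Type) (X : set G) (H : L -> set G).

(* The disjoint union of X and of the H l \ {1}: a letter remembers which of
   these sets it comes from, even if the sets overlap in G. *)
Inductive letter : Type :=
  | LX (x : X)
  | LH (l : L) (h : (H l `\ 1)%classic).

Definition letter_val (a : letter) : G :=
  match a with LX x => \val x | LH _ h => \val h end.

Definition word_val (w : seq letter) : G := \prod_(a <- w) letter_val a.

Definition rel_generating : Prop :=
  (forall x, X x -> X x^-1) /\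
  generated (X `|` \bigcup_l H l) = setT.

(* Elements of F = ( * _l H l) * F(X) are represented by words in letters and
   their formal inverses; (a, true) stands for the formal inverse of a. *)
Definition fword : Type := seq (letter * bool).

Definition finv (w : fword) : fword := rev [seq (u.1, ~~ u.2) | u <- w].

Definition of_word (w : seq letter) : fword := [seq (a, false) | a <- w].

Definition fword_val (w : fword) : G :=
  \prod_(u <- w) (if u.2 then (letter_val u.1)^-1 else letter_val u.1).

(* Equality in F: free cancellation, together with all the relations that hold
   in one of the groups H l. *)
Inductive eqF : fword -> fword -> Prop :=
  | eqF_refl u : eqF u u
  | eqF_sym u v : eqF u v -> eqF v u
  | eqF_trans u v w : eqF u v -> eqF v w -> eqF u w
  | eqF_cat u u' v v' : eqF u u' -> eqF v v' -> eqF (u ++ v) (u' ++ v')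
  | eqF_cancel a b : eqF [:: (a, b); (a, ~~ b)] [::]
  | eqF_H l (s : seq (H l `\ 1)%classic) :
      \prod_(h <- s) \val h = 1 -> eqF (of_word [seq LH h | h <- s]) [::].

Inductive normal_closure (Rel : set fword) : fword -> Prop :=
  | nc_rel r : Rel r -> normal_closure Rel r
  | nc_eq u v : eqF u v -> normal_closure Rel u -> normal_closure Rel v
  | nc_one : normal_closure Rel [::]
  | nc_mul u v : normal_closure Rel u -> normal_closure Rel v ->
      normal_closure Rel (u ++ v)
  | nc_inv u : normal_closure Rel u -> normal_closure Rel (finv u)
  | nc_conj f u : normal_closure Rel u ->
      normal_closure Rel (finv f ++ u ++ f).

Definition rel_presentation (Rel : set fword) : Prop :=
  rel_generating /\
  forall w : fword, fword_val w = 1 <-> normal_closure Rel w.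

Definition conj_product (Rel : set fword) (W : seq letter) : set nat :=
  [set k | exists (f r : 'I_k -> fword) (e : 'I_k -> bool),
     (forall i, Rel (r i)) /\
     eqF (of_word W)
       (\big[cat/[::]]_(i < k)
          (finv (f i) ++ (if e i then finv (r i) else r i) ++ f i))].

Definition is_rel_area (Rel : set fword) (W : seq letter) (k : nat) : Prop :=
  conj_product Rel W k /\
  forall j, conj_product Rel W j -> (k <= j)%N.

Definition linear_rel_area (Rel : set fword) : Prop :=
  exists C : nat, forall W : seq letter, word_val W = 1 ->
    exists2 k, is_rel_area Rel W k & (k <= C * size W)%N.

End RelativePresentation.

Definition rel_hyperbolic (G : groupType) (L : Type) (H : L -> set G) : Prop :=
  exists (X : set G) (Rel : set (fword X H)),
    [/\ finite_set X, finite_set Rel, rel_presentation Rel &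
        linear_rel_area Rel].

Section Paths.
Variables (R : realType) (G : groupType) (L : Type).
Variables (X : set G) (H : L -> set G).

(* A path in the Cayley graph is determined by its origin and its label.  As X
   and the H l are closed under inverses, traversing an edge backwards amounts
   to traversing the edge labelled by the inverse letter. *)
Record cayley_path : Type :=
  CayleyPath { origin : G; label : seq (letter X H) }.

Implicit Types (p q : cayley_path) (l : L).

Definition len p : nat := size (label p).

Definition vertex p (n : nat) : G := origin p * word_val (take n (label p)).

Definition terminus p : G := vertex p (len p).

Definition is_cycle p : Prop := terminus p = origin p.

Definition cayley_dist (g h : G) : \bar R :=
  ereal_inf [set ((len p)%:R%:E)%E | p in
               [set p | origin p = g /\ terminus p = h]].

(* A subpath is given by the positions s.1 <= s.2 of its endpoints, so that
   different occurrences of the same sequence of edges are distinguished. *)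
Definition subpath : Type := (nat * nat)%type.

Implicit Types s t : subpath.

Definition is_subpath p s : Prop := (s.1 <= s.2 <= len p)%N.

Definition sub_start p s : G := vertex p s.1.

Definition sub_end p s : G := vertex p s.2.

Definition sub_val p s : G :=
  word_val (take (s.2 - s.1) (drop s.1 (label p))).

Definition sub_vertices p s : set G :=
  [set vertex p n | n in [set n | (s.1 <= n <= s.2)%N]].

Definition H_labelled l p s : Prop :=
  forall n, (s.1 <= n < s.2)%N ->
    exists h : (H l `\ 1)%classic, onth (label p) n = Some (LH X h).

Definition is_H_component l p s : Prop :=
  [/\ is_subpath p s, (s.1 < s.2)%N, H_labelled l p s &
      forall t, is_subpath p t -> H_labelled l p t ->
        (t.1 <= s.1)%N -> (s.2 <= t.2)%N -> t = s].

Definition H_connected l p s q t : Prop :=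
  exists a : G, forall v, (sub_vertices p s `|` sub_vertices q t) v ->
    H l (a^-1 * v).

Definition H_isolated l p s : Prop :=
  is_H_component l p s /\
  forall t, is_H_component l p t -> t <> s -> ~ H_connected l p s p t.

Definition without_backtracking p : Prop :=
  forall l s, is_H_component l p s -> H_isolated l p s.

Definition phase_vertices p : set G :=
  [set vertex p n | n in
     [set n | (n <= len p)%N /\
        forall l s, is_H_component l p s -> ~ (s.1 < n < s.2)%N]].

Definition quasi_geodesic (mu c : R) p : Prop :=
  forall s, is_subpath p s ->
    (((s.2 - s.1)%N%:R)%:E
       <= mu%:E * cayley_dist (sub_start p s) (sub_end p s) + c%:E)%E.

Definition k_similar (k : R) p q : Prop :=
  (maxe (word_dist R X (origin p) (origin q))
        (word_dist R X (terminus p) (terminus q))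
     <= k%:E)%E.

Definition isolated_components_bound (M : R) (Omega : L -> set G) : Prop :=
  [/\ (0 < M)%R,
      forall l, Omega l `<=` H l,
      finite_set (\bigcup_l Omega l) &
      forall q l (ps : seq subpath),
        is_cycle q -> uniq ps -> (forall s, s \in ps -> H_isolated l q s) ->
        (forall s, s \in ps -> generated (Omega l) (sub_val q s)) /\
        (\sum_(s <- ps) word_length R (Omega l) (sub_val q s)
           <= (M * (len q)%:R)%:E)%E].

End Paths.

(* Main.v *)
Require Import Defs.
From mathcomp Require Import all_boot all_order all_algebra.
From mathcomp Require Import boolp classical_sets functions cardinality.
From mathcomp Require Import reals constructive_ereal ereal.
From mathcomp Require Import zify.

(** The whole theorem is reduced to one inequality of Stokes type in the Cayley
graph of [G] with respect to [X] and the [H l], together with the bound on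
isolated components applied to one edge at a time.

Stokes inequality ([stokes]).  Let [f] and [u] be integer functions on [G]
that are 1-Lipschitz for the metric of the Cayley graph.  Along a closed path
of length [n] the sum of [f v_i * (u v_{i+1} - u v_i)], the integral of the
one-form f du, is at most [A * n] in absolute value.  Indeed, once the
coefficient of the form is made constant on the [H l]-edges inside each coset
of [H l], its integral along a word respects all the relations of the free
product F of the [H l] and the free group on the remaining letters.  Writing a
word that is trivial in [G] as a product of conjugates of relators in F, the
conjugating words cancel, each relator contributes a bounded amount, and the
number of relators is linear in the length of the word: this is where relative
hyperbolicity enters.

Stability of quasi-geodesics ([morse]).  Suppose that [p] makes an excursion
out of the [T]-neighbourhood of [q], and close it up by two geodesics of length
at most [T] and a piece of [q].  Take for [f] the distance to [q] truncated at [T], and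
for [u] the distance to the beginning of the excursion.  Then [f] is [T] on the
excursion and 0 on [q], so the integral is [T] times the distance d between the
ends of the excursion, up to a constant.  The length of the loop is at most a
multiple of d plus a constant, because [p] and [q] are quasi-geodesics.  When
[T] exceeds that multiple times [A], the Stokes inequality bounds d, hence the
excursion.

Bounded penetration.  Suppose that an [H l]-edge is closed up to a loop of
length [n + 1] by a walk without any [H l]-edge that starts in the coset of
[H l] containing the edge.  The edge is then an isolated component of the loop,
and its length with respect to Omega is linear in [n]
([isolated_edge_bound]).  Every estimate in the metric of X and Omega comes
from such a loop.  If a vertex [u] of [p] is near a vertex of [q], and the coset
is near [u], go back along [p] from [u] by a fixed number of steps, cross to [q]
by a geodesic, which is short by [morse], and return along [q].  The crossing is
too far from the coset to meet it; if the path is too short for that, go back to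
its origin and cross by edges labelled in [X] ([left_frame], [left_loop]).
Reversing the paths gives loops on the other side of [u].

Let [s] and [t] be connected components of [p] and [q].  Since there is no
backtracking, [p] before [s] and [q] before [t] have no edge in their common
coset, so that the left loop compares the starting points; the right loop
compares the end points.  If [s] is connected to no component of [q], its left
and right loops are joined along [q] to show that [s] is short
([missed_coset_short]).  Finally let [u] be a phase vertex of [p], and follow a
geodesic from [u] to a phase vertex of [q].  An [H l]-edge of the geodesic
determines a coset, which [p] cannot visit both before and after [u], because
[u] is phase.  On the side not visited, either [q] does not visit the coset
either, and the edge is short, or the first edge of [q] that the loop meets in
the coset starts at a phase vertex, which can be reached at bounded cost
([phase_close]). *)

Set Implicit Arguments.
Unset Strict Implicit.
Unset Printing Implicit Defensive.

Import Order.TTheory GRing.Theory Num.Theory.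

Local Open Scope classical_set_scope.
Local Open Scope group_scope.

(** * Subgroups and finite sets *)

Lemma subgroup1 (G : groupType) (S : set G) : is_subgroup S -> S 1.
Proof. by case; rewrite inE. Qed.

Lemma subgroupV (G : groupType) (S : set G) (x : G) :
  is_subgroup S -> S x -> S x^-1.
Proof.
by move=> /group_closedV SV Sx; have := SV x; rewrite !inE; apply.
Qed.

Lemma subgroupM (G : groupType) (S : set G) (x y : G) :
  is_subgroup S -> S x -> S y -> S (x * y).
Proof.
by move=> /group_closedM SM Sx Sy; have := SM x y; rewrite !inE; apply.
Qed.

Lemma is_subgroupI (G : groupType) (S : set G) :
  S 1 -> (forall x y, S x -> S y -> S (x * y)) -> (forall x, S x -> S x^-1) ->
  is_subgroup S.
Proof.
move=> S1 SM SV; split; first by rewrite inE.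
by move=> x y; rewrite !inE => Sx Sy; apply: SM => //; apply: SV.
Qed.

Lemma finite_uniform (T : Type) (A : set T) (P : nat -> T -> Prop) :
  finite_set A -> (forall m n x, (m <= n)%N -> P m x -> P n x) ->
  (forall x, A x -> exists n, P n x) ->
  exists N, forall x, A x -> P N x.
Proof.
move=> /(@finite_seqP {classic T})[s ->] Pmono.
elim: s => [|y s IHs] PA; first by exists 0%N.
have [|N PN] := IHs.
  by move=> x xs; apply: PA; rewrite /= inE [x \in s]xs orbT.
have [|n Pn] := PA y; first by rewrite /= mem_head.
exists (maxn N n) => x /=; rewrite inE => /orP[/eqP->|xs].
  by apply: Pmono Pn; rewrite leq_maxr.
by apply: Pmono (PN _ xs); rewrite leq_maxl.
Qed.

(** * Walks in the Cayley graph and their length metric *)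

Section Walks.
Variables (G : groupType) (L : Type) (X : set G) (H : L -> set G).

(** [None] stands for an edge labelled in [X] and [Some l] for one labelled in
[H l \ {1}].  Keeping the kind of an edge instead of its letter is enough to
speak of components, and makes steps symmetric. *)
Definition step (t : option L) (x y : G) : Prop :=
  if t is Some l then H l (x^-1 * y) /\ x <> y else X (x^-1 * y).

Inductive walk (ok : option L -> G -> Prop) : nat -> G -> G -> Prop :=
  | walk_nil x : walk ok 0 x x
  | walk_cons n t x y z :
      ok t x -> step t x y -> walk ok n y z -> walk ok n.+1 x z.

Definition anywhere (t : option L) (x : G) : Prop := True.
Definition only_X (t : option L) (x : G) : Prop := t = None.

(** Meant for [C] a coset of [H l]: since an [H l]-edge cannot leave its coset,
forbidding its starting point amounts to forbidding its end point. *)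
Definition avoid l (C : set G) (t : option L) (x : G) : Prop :=
  t = Some l -> ~ C x.

Definition coset l g : set G := [set x | H l (g^-1 * x)].

Implicit Types (ok : option L -> G -> Prop) (x y z g : G) (l : L).

Lemma walk_imp ok ok' n x y :
  (forall t x, ok t x -> ok' t x) -> walk ok n x y -> walk ok' n x y.
Proof.
by move=> okW; elim=> [z|{}n t a b z /okW ? ? _ ?]; [left|right with t b].
Qed.

Lemma walk_any ok n x y : walk ok n x y -> walk anywhere n x y.
Proof. by apply: walk_imp. Qed.

Lemma walk_only_X l (C : set G) n x y :
  walk only_X n x y -> walk (avoid l C) n x y.
Proof. by apply: walk_imp => t z ->. Qed.

Lemma walk_cat ok m n x y z :
  walk ok m x y -> walk ok n y z -> walk ok (m + n) x z.
Proof.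
elim=> // {}m t a b c ok_a ab _ IH /IH w.
by rewrite addSn; right with t b.
Qed.

Lemma walk1 ok t x y : ok t x -> step t x y -> walk ok 1 x y.
Proof. by move=> okx xy; right with t y; last left. Qed.

Lemma walk_segment ok (v : nat -> G) (t : nat -> option L) m n :
  (m <= n)%N ->
  (forall j, (m <= j < n)%N -> ok (t j) (v j) /\ step (t j) (v j) (v j.+1)) ->
  walk ok (n - m) (v m) (v n).
Proof.
move=> le_mn; rewrite -(subnKC le_mn) addKn.
elim: (n - m)%N => [|d IHd] vt; first by rewrite addn0; left.
rewrite -[in X in walk _ X]addn1; apply: walk_cat (IHd _) _ => [j|].
  by move=> /andP[mj jd]; apply: vt; rewrite mj /= addnS ltnS ltnW.
have [|okd std] := vt (m + d)%N; first by rewrite leq_addr addnS /=.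
by rewrite addnS; apply: walk1 okd std.
Qed.

Hypothesis (XV : forall x, X x -> X x^-1) (HH : forall l, is_subgroup (H l)).

Lemma step_sym t x y : step t x y -> step t y x.
Proof.
case: t => [l|] /=; last by move=> /XV; rewrite invgM invgK.
case=> /(subgroupV (HH l)) + xy; rewrite invgM invgK; split=> //.
exact: nesym.
Qed.

Lemma stepMl t g x y : step t (g * x) (g * y) = step t x y.
Proof.
rewrite /step invgM -mulgA mulKg; case: t => // l.
by apply/propext; split=> -[h xy]; split=> //;
  [move=> exy; apply: xy; rewrite exy|move/mulgI].
Qed.

Lemma walk_rev ok n x y :
  (forall t x y, step t x y -> ok t x -> ok t y) ->
  walk ok n x y -> walk ok n y x.
Proof.
move=> okS; elim=> [z|{}n t a b z oka ab _ IH]; first by left.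
rewrite -addn1; apply: walk_cat IH _; apply: walk1 (okS _ _ _ ab oka) _.
exact: step_sym.
Qed.

Lemma walk_any_rev n x y : walk anywhere n x y -> walk anywhere n y x.
Proof. exact: walk_rev. Qed.

Lemma cosetP l g x y : coset l g x -> coset l g y <-> H l (x^-1 * y).
Proof.
rewrite /coset /= => gx; split=> [gy|xy].
  have -> : x^-1 * y = (g^-1 * x)^-1 * (g^-1 * y).
    by rewrite invgM invgK mulgA mulgK.
  by apply: subgroupM => //; apply: subgroupV.
have -> : g^-1 * y = g^-1 * x * (x^-1 * y) by rewrite mulgA mulgK.
exact: subgroupM.
Qed.

Lemma coset_refl l g : coset l g g.
Proof. by rewrite /coset /= mulVg; apply: subgroup1. Qed.

Lemma coset_step l g x y : step (Some l) x y -> coset l g x -> coset l g y.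
Proof. by case=> xy _ gx; apply/(cosetP _ gx). Qed.

(** Avoiding a coset is a symmetric condition, although it is stated for starting
points. *)
Lemma walk_avoid_rev l g n x y :
  walk (avoid l (coset l g)) n x y -> walk (avoid l (coset l g)) n y x.
Proof.
apply: walk_rev => t a b ab Ca tl Cb; apply: Ca => //.
by move: Cb; apply: coset_step; apply: step_sym; rewrite -tl.
Qed.

Lemma walkMl n g x y : walk anywhere n x y -> walk anywhere n (g * x) (g * y).
Proof.
elim=> [z|{}n t a b z _ ab _ IH]; first by left.
by right with t (g * b); rewrite ?stepMl.
Qed.

Lemma walk_coset l x y : H l (x^-1 * y) ->
  exists2 n, (n <= 1)%N & walk anywhere n x y.
Proof.
move=> xy; have [<-|nxy] := pselect (x = y); first by exists 0%N => //; left.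
by exists 1%N => //; apply: (@walk1 _ (Some l)).
Qed.

Hypothesis genX : generated (X `|` \bigcup_l H l) = setT.

(** The metric is finite because [X] and the [H l] together generate [G]. *)
Lemma walk_ex x y : exists n, `[< walk anywhere n x y >].
Proof.
suff [n w] : exists n, walk anywhere n 1 (x^-1 * y).
  by exists n; apply/asboolP; have := walkMl x w; rewrite mulg1 mulVKg.
pose S := [set g | exists n, walk anywhere n 1 g].
suff : generated (X `|` \bigcup_l H l) `<=` S by apply; rewrite genX.
apply: smallest_sub.
  apply: is_subgroupI.
  - by exists 0%N; left.
  - move=> a b [m wa] [n wb]; exists (m + n)%N; apply: walk_cat wa _.
    by rewrite -[X in walk _ _ X]mulg1; apply: walkMl.
  - move=> a [m wa]; exists m; apply: walk_any_rev.
    by have := walkMl a^-1 wa; rewrite mulVg mulg1.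
move=> a [Xa|[l _ Ha]].
  by exists 1%N; apply: (@walk1 _ None) => //=; rewrite invg1 mul1g.
by have [|n _ w] := @walk_coset l 1 a; [rewrite invg1 mul1g|exists n].
Qed.

Definition dist x y := ex_minn (walk_ex x y).

Lemma dist_walk x y : walk anywhere (dist x y) x y.
Proof. by rewrite /dist; case: ex_minnP => n /asboolP. Qed.

Lemma dist_le ok n x y : walk ok n x y -> (dist x y <= n)%N.
Proof.
move=> /walk_any w; rewrite /dist; case: ex_minnP => m _; apply.
exact/asboolP.
Qed.

Lemma distxx x : dist x x = 0%N.
Proof. by apply/eqP; rewrite -leqn0; apply: (@dist_le anywhere); left. Qed.

Lemma distC x y : dist x y = dist y x.
Proof.
by apply/eqP; rewrite eqn_leq; apply/andP; split;
  apply: (@dist_le anywhere); apply: walk_any_rev; apply: dist_walk.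
Qed.

Lemma dist_tri y x z : (dist x z <= dist x y + dist y z)%N.
Proof. by apply: (@dist_le anywhere); apply: walk_cat; apply: dist_walk. Qed.

Lemma distMl g x y : dist (g * x) (g * y) = dist x y.
Proof.
apply/eqP; rewrite eqn_leq; apply/andP; split;
  apply: (@dist_le anywhere); first by apply: walkMl; apply: dist_walk.
have := walkMl g^-1 (dist_walk (g * x) (g * y)).
by rewrite !mulKg.
Qed.

Lemma dist_step t x y : step t x y -> (dist x y <= 1)%N.
Proof. by move=> xy; apply: (@dist_le anywhere); apply: walk1 xy. Qed.

Lemma dist_coset l g x y : coset l g x -> coset l g y -> (dist x y <= 1)%N.
Proof.
move=> gx gy; have /walk_coset[n n1 w] : H l (x^-1 * y) by apply/(cosetP _ gx).
exact: leq_trans (dist_le w) n1.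
Qed.

(** A walk that meets the coset in an edge comes within distance 1 of each of its
points before the last step.  This covers both walks that stay far away from
the coset and geodesic segments that just reach it. *)
Lemma walk_avoid l g n x y z :
  coset l g z -> (n < dist x z)%N -> walk anywhere n x y ->
  walk (avoid l (coset l g)) n x y.
Proof.
move=> gz far w; elim: w far => [a|{}n t a b c _ ab _ IH] far; first by left.
right with t b => //.
  by move=> _ ga; have := dist_coset ga gz; lia.
by apply: IH; have := dist_tri b a z; have := dist_step ab; lia.
Qed.

End Walks.

(** * One-forms on the Cayley graph *)

Section Cochain.
Variables (G : groupType) (L : Type) (X : set G) (H : L -> set G).
Hypothesis HH : forall l, is_subgroup (H l).
Variables (f u : G -> int).

Definition signed_val (e : letter X H * bool) : G :=
  if e.2 then (letter_val e.1)^-1 else letter_val e.1.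

Definition flip_letter (e : letter X H * bool) := (e.1, ~~ e.2).

(** The coefficient of the one-form on an edge.  On an [X]-edge it is the value
of [f] at the origin of the positively oriented edge.  On an [H l]-edge it is
the value of [f] at a representative of the coset, a choice that makes the
integral of an [H l]-word telescope. *)
Definition anchor (g : G) (e : letter X H * bool) : int :=
  match e.1 with
  | LX _ => f (if e.2 then g * signed_val e else g)
  | LH l _ => f (xget 1 (coset H l g))
  end.

Definition form g e : int := (anchor g e * (u (g * signed_val e)%g - u g))%R.

Fixpoint integral g (w : fword X H) : int :=
  if w is e :: w' then (form g e + integral (g * signed_val e)%g w')%R else 0%R.

Lemma fword_val_nil : fword_val ([::] : fword X H) = 1.
Proof. by rewrite /fword_val big_nil. Qed.

Lemma fword_val_cons e (w : fword X H) :
  fword_val (e :: w) = signed_val e * fword_val w.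
Proof. by rewrite /fword_val big_cons. Qed.

Lemma fword_val_cat (v w : fword X H) :
  fword_val (v ++ w) = fword_val v * fword_val w.
Proof. by rewrite /fword_val big_cat. Qed.

Lemma integral_cat g v w :
  integral g (v ++ w) = (integral g v + integral (g * fword_val v)%g w)%R.
Proof.
elim: v g => [|e v IHv] g /=; first by rewrite fword_val_nil mulg1 add0r.
by rewrite IHv fword_val_cons mulgA addrA.
Qed.

Lemma signed_val_flip e : signed_val (flip_letter e) = (signed_val e)^-1.
Proof. by case: e => a []; rewrite /signed_val /= ?invgK. Qed.

Lemma letter_valH l (h : (H l `\ 1)%classic) : H l (letter_val (LH X h)).
Proof. by case: h => h hP; have := set_mem hP; case. Qed.

Lemma cosetMr l g h : H l h -> coset H l (g * h) = coset H l g.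
Proof.
move=> Hh; apply/seteqP.
have gh : coset H l g (g * h) by rewrite /coset /= mulKg.
split=> y; last by move=> gy; apply/(cosetP HH _ gh).
by move=> ghy; apply/(cosetP HH _ (coset_refl HH l g)); apply/(cosetP HH _ gh).
Qed.

Lemma form_flip g e :
  form (g * signed_val e)%g (flip_letter e) = (- form g e)%R.
Proof.
rewrite /form signed_val_flip mulgK -mulrN opprB; congr (_ * _)%R.
case: e => -[x|l h] b; rewrite /anchor /=.
  by rewrite signed_val_flip mulgK; case: b.
rewrite cosetMr //; case: b; last exact: letter_valH.
by apply: subgroupV => //; apply: letter_valH.
Qed.

Lemma finv_cons e (w : fword X H) :
  Defs.finv (e :: w) = Defs.finv w ++ [:: flip_letter e].
Proof. by rewrite /Defs.finv /= rev_cons cats1. Qed.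

Lemma fword_val_finv (w : fword X H) :
  fword_val (Defs.finv w) = (fword_val w)^-1.
Proof.
elim: w => [|e w IHw]; first by rewrite fword_val_nil invg1.
by rewrite finv_cons fword_val_cat !fword_val_cons fword_val_nil mulg1 IHw
  signed_val_flip invgM.
Qed.

Lemma integral_finv g w :
  integral (g * fword_val w)%g (Defs.finv w) = (- integral g w)%R.
Proof.
elim: w g => [|e w IHw] g; first by rewrite /= oppr0.
rewrite finv_cons integral_cat fword_val_finv fword_val_cons /= mulgA mulgK.
by rewrite IHw form_flip addr0 opprD addrC.
Qed.

Lemma integral_conj g v w : fword_val w = 1 ->
  integral g (Defs.finv v ++ w ++ v) = integral (g * (fword_val v)^-1)%g w.
Proof.
move=> w1; rewrite !integral_cat w1 mulg1 fword_val_finv.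
rewrite -{1}(mulgVK (fword_val v) g) integral_finv; lia.
Qed.

(** The coefficient is constant along the word, and the increments of [u] add
up. *)
Lemma integral_H g l (s : seq (H l `\ 1)%classic) :
  let h := \prod_(x <- s) \val x in
  H l h /\ integral g (of_word [seq LH X h | h <- s]) =
           (f (xget 1%g (coset H l g)) * (u (g * h)%g - u g))%R.
Proof.
elim: s g => [|x s IHs] g /=.
  by rewrite big_nil mulg1 subrr mulr0; split=> //; apply: subgroup1.
have [Hh] := IHs (g * signed_val (LH X x, false)); rewrite big_cons /of_word => ->.
have Hx := letter_valH x; split; first exact: subgroupM.
by rewrite /form /anchor /= cosetMr //= /signed_val /= mulgA -mulrDr addrC subrKA.
Qed.

(** The one-form is closed on the relations of F: each cancelling pair
contributes opposite terms, and a relation of [H l] is a closed word inside one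
coset. *)
Lemma integral_eqF v w : eqF v w ->
  fword_val v = fword_val w /\ forall g, integral g v = integral g w.
Proof.
elim=> [//|{}v {}w _ [-> IH]|v1 v2 v3 _ [-> IH] _ [-> IH']
  |v1 w1 v2 w2 _ [e1 I1] _ [e2 I2]|a b|l s s1].
- by split=> // g; rewrite IH.
- by split=> // g; rewrite IH IH'.
- by rewrite !fword_val_cat e1 e2; split=> // g; rewrite !integral_cat I1 I2 e1.
- pose e := (a, b); rewrite -[(a, ~~ b)]/(flip_letter e) -[(a, b)]/e.
  rewrite !fword_val_cons fword_val_nil mulg1 signed_val_flip mulgV; split=> // g /=.
  by rewrite form_flip addr0 subrr.
- split=> [|g].
    rewrite fword_val_nil -[RHS]s1 /fword_val big_map big_map.
    by apply: eq_bigr => h _.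
  by have [_ ->] := integral_H g s; rewrite s1 mulg1 subrr mulr0.
Qed.

Variable K : nat.
Hypothesis fK : forall g (a : letter X H),
  (`|f (g * letter_val a)%g - f g| <= K%:Z)%R.
Hypothesis uK : forall g (a : letter X H),
  (`|u (g * letter_val a)%g - u g| <= K%:Z)%R.

Lemma signed_valK (w : G -> int) g e :
  (forall g (a : letter X H), (`|w (g * letter_val a)%g - w g| <= K%:Z)%R) ->
  (`|w (g * signed_val e)%g - w g| <= K%:Z)%R.
Proof.
move=> wK; case: e => a []; rewrite /signed_val /=; last exact: wK.
by have := wK (g * (letter_val a)^-1) a; rewrite mulgVK distrC.
Qed.

Lemma anchorK g e : (`|anchor g e - f g| <= K%:Z)%R.
Proof.
case: e => -[x|l h] b; rewrite /anchor /=.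
  by case: b; [apply: signed_valK|rewrite subrr normr0].
have : coset H l g (xget 1 (coset H l g)).
  by apply: xgetPex; exists g; apply: coset_refl.
set y := xget _ _; rewrite /coset /= => gy.
have [gy1|ngy1] := pselect (g^-1 * y = 1).
  suff -> : y = g by rewrite subrr normr0.
  by rewrite -(mulVKg g y) gy1 mulg1.
have gyP : (g^-1 * y) \in (H l `\ 1)%classic by rewrite inE.
by have := fK g (LH X (SigSub gyP)); rewrite /= mulVKg.
Qed.

(** Freezing the coefficient at its initial value turns the integral into a
difference of values of [u]; along a word of length [n] the coefficient moves by
at most [n * K], whence a quadratic error.  In particular the integral along a
closed word is bounded in terms of its length. *)
Lemma integral_err g w :
  (`|u (g * fword_val w)%g - u g| <= (size w * K)%:Z)%R /\
  (`|integral g w - f g * (u (g * fword_val w)%g - u g)|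
     <= ((size w)^2 * K^2)%:Z)%R.
Proof.
elim: w g => [|e w IHw] g.
  by rewrite fword_val_nil mulg1 subrr mulr0.
have [Iu Ii] := IHw (g * signed_val e)%g; move: Iu Ii => /=.
rewrite fword_val_cons mulgA /form.
have := anchorK g e; have := signed_valK g e fK; have := signed_valK g e uK.
move: (integral _ _) (anchor g e) (f (g * signed_val e)) (f g) (u (_ * fword_val w)).
move: (u (g * signed_val e)) (u g) (size w).
move=> ug' ug n I a fg' fg ug'' h1 h2 h3 h4 h5; split; first by lia.
(* The error on the first edge, the change of coefficient over that edge, and
   the error on the rest of the word. *)
have e1 : (a * (ug' - ug) + I - fg * (ug'' - ug) =
  (a - fg) * (ug' - ug) + (fg' - fg) * (ug'' - ug') + (I - fg' * (ug'' - ug')))%R.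
  lia.
have b1 : (`|(a - fg) * (ug' - ug)| <= K%:Z * K%:Z)%R.
  by rewrite normrM; apply: ler_pM; rewrite ?normr_ge0.
have b2 : (`|(fg' - fg) * (ug'' - ug')| <= K%:Z * (n * K)%:Z)%R.
  by rewrite normrM; apply: ler_pM; rewrite ?normr_ge0.
have : (K%:Z * K%:Z + K%:Z * (n * K)%:Z + (n^2 * K^2)%:Z <= (n.+1^2 * K^2)%:Z)%R.
  nia.
rewrite e1; move: h5 b1 b2; move: (_ * _)%R (_ * _)%R (_ - _)%R => x y z; lia.
Qed.

(** By invariance, only the relators contribute to the integral of a product of
conjugates of relators. *)
Lemma conj_product_integral (Rel : set (fword X H)) (r : nat) W k :
  (forall w, Rel w -> fword_val w = 1) ->
  (forall w, Rel w -> (size w <= r)%N) ->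
  conj_product Rel W k ->
  forall g, (`|integral g (of_word W)| <= (k * (r^2 * K^2))%:Z)%R.
Proof.
move=> Rel1 Relr [c [s [e [Rs]]]] /integral_eqF[_ IW] g; rewrite {}IW.
pose F i := Defs.finv (c i) ++ (if e i then Defs.finv (s i) else s i) ++ c i.
rewrite -[\big[_/_]_(i < k) _]/(\big[cat/[::]]_(i < k) F i).
have F1 i : fword_val (F i) = 1 /\
    forall g, (`|integral g (F i)| <= (r^2 * K^2)%:Z)%R.
  have s1 : fword_val (if e i then Defs.finv (s i) else s i) = 1.
    by case: (e i); rewrite ?fword_val_finv Rel1 ?invg1.
  split=> [|g'].
    by rewrite /F !fword_val_cat s1 mul1g fword_val_finv mulVg.
  rewrite /F integral_conj //; move: (g' * _)%g => g''.
  have [_] := integral_err g'' (s i); have := Relr _ (Rs i).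
  rewrite Rel1 // mulg1 subrr mulr0 subr0 => sr /le_trans.
  have -> : (`|integral g'' (if e i then Defs.finv (s i) else s i)| =
             `|integral g'' (s i)|)%R.
    case: (e i) => //; rewrite -[g'']mulg1 -(Rel1 _ (Rs i)) integral_finv.
    by rewrite normrN Rel1 // mulg1.
  by apply; rewrite lez_nat leq_mul // leq_sqr.
have -> : (k * (r^2 * K^2) = \sum_(i < k) (r^2 * K^2))%N.
  by rewrite sum_nat_const card_ord.
suff : fword_val (\big[cat/[::]]_(i < k) F i) = 1 /\ forall g,
  (`|integral g (\big[cat/[::]]_(i < k) F i)| <= (\sum_(i < k) (r^2 * K^2))%:Z)%R.
  by case.
apply: (big_ind2 (fun w m => fword_val w = 1 /\
  forall g, (`|integral g w| <= (m)%:Z)%R)).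
- by rewrite fword_val_nil.
- move=> w1 m1 w2 m2 [v1 I1] [v2 I2]; rewrite fword_val_cat v1 v2 mulg1.
  split=> // g'; rewrite integral_cat; have := I1 g'.
  have := I2 (g' * fword_val w1); lia.
- by move=> i _; apply: F1.
Qed.

End Cochain.

(** * Integrals along walks *)

Section WalkWord.
Variables (G : groupType) (L : Type) (X : set G) (H : L -> set G).

Definition ltype (a : letter X H) : option L :=
  if a is LH l _ then Some l else None.

Lemma step_letter t x y : step X H t x y ->
  exists a : letter X H, ltype a = t /\ x * letter_val a = y.
Proof.
case: t => [l [xy nxy]|xy] /=.
  have hP : (x^-1 * y) \in (H l `\ 1)%classic.
    by rewrite inE; split=> // /= xy1; apply: nxy; rewrite -(mulVKg x y) xy1 mulg1.
  by exists (LH X (SigSub hP)); rewrite /= mulVKg.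
have hP : (x^-1 * y) \in X by rewrite inE.
by exists (LX H (SigSub hP)); rewrite /= mulVKg.
Qed.

Lemma letter_step x (a : letter X H) : step X H (ltype a) x (x * letter_val a).
Proof.
case: a => [[y yP]|l [y yP]] /=; rewrite mulKg; first exact: set_mem yP.
have [Hy ny1] := set_mem yP; split=> // xy; apply: ny1 => /=.
by apply: (@mulgI _ x); rewrite mulg1.
Qed.

Lemma word_val_cons (a : letter X H) w :
  word_val (a :: w) = letter_val a * word_val w.
Proof. by rewrite /word_val big_cons. Qed.

Lemma word_val_cat (v w : seq (letter X H)) :
  word_val (v ++ w) = word_val v * word_val w.
Proof. by rewrite /word_val big_cat. Qed.

Lemma word_val_nil : word_val ([::] : seq (letter X H)) = 1.
Proof. by rewrite /word_val big_nil. Qed.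

Lemma walk_word ok n x y : walk X H ok n x y ->
  exists w : seq (letter X H), [/\ size w = n, x * word_val w = y &
    forall m a, onth w m = Some a -> ok (ltype a) (x * word_val (take m w))].
Proof.
elim=> [z|{}n t a b c oka /step_letter[d [dt ad]] _ [w [sw bw okw]]].
  by exists [::]; rewrite word_val_nil mulg1; split=> // m d; rewrite onth0n.
exists (d :: w); rewrite /= sw word_val_cons mulgA ad bw; split=> // -[|m] e /=.
  by case=> <-; rewrite word_val_nil mulg1 dt.
by move=> /okw; rewrite word_val_cons mulgA ad.
Qed.

(** Making the integral an index of the relation avoids naming the intermediate
vertices of a loop glued from several pieces. *)
Inductive walk_integral (f u : G -> int) : nat -> G -> G -> int -> Prop :=
  | wint_nil x : walk_integral f u 0 x x 0%R
  | wint_cons n t x y z i : step X H t x y -> walk_integral f u n y z i ->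
      walk_integral f u n.+1 x z (f x * (u y - u x) + i)%R.

Lemma wint_cat f u m n x y z i j :
  walk_integral f u m x y i -> walk_integral f u n y z j ->
  walk_integral f u (m + n) x z (i + j)%R.
Proof.
elim=> [a|{}m t a b c k ab _ IH /IH w]; first by rewrite add0r.
by rewrite addSn -addrA; right with t.
Qed.

Lemma walk_wint (f u : G -> int) ok n x y :
  walk X H ok n x y -> exists i, walk_integral f u n x y i.
Proof.
elim=> [a|{}n t a b c _ ab _ [i w]]; first by exists 0%R; left.
by exists (f a * (u b - u a) + i)%R; right with t.
Qed.

Lemma wint_segment (f u : G -> int) c (v : nat -> G) (t : nat -> option L) m n :
  (m <= n)%N ->
  (forall j, (m <= j < n)%N -> step X H (t j) (v j) (v j.+1)) ->
  (forall j, (m <= j <= n)%N -> f (v j) = c) ->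
  walk_integral f u (n - m) (v m) (v n) (c * (u (v n) - u (v m)))%R.
Proof.
move=> le_mn; rewrite -(subnKC le_mn) addKn.
elim: (n - m)%N => [|d IHd] vt fc; first by rewrite addn0 subrr mulr0; left.
have -> : (c * (u (v (m + d.+1)%N) - u (v m)) = c * (u (v (m + d)%N) - u (v m)) +
   (f (v (m + d)%N) * (u (v (m + d.+1)%N) - u (v (m + d)%N)) + 0))%R.
  rewrite (fc (m + d)%N); [lia|lia].
rewrite -[in X in walk_integral _ _ X]addn1; apply: wint_cat.
  by apply: IHd => j jd; [apply: vt|apply: fc]; lia.
right with (t (m + d)%N); last by left.
by rewrite addnS; apply: vt; lia.
Qed.

Lemma wint_bound (f u : G -> int) (T : nat) n x y i :
  (forall x, `|f x| <= T%:Z)%R ->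
  (forall t x y, step X H t x y -> `|u y - u x| <= 1)%R ->
  walk_integral f u n x y i -> (`|i| <= (T * n)%:Z)%R.
Proof.
move=> fT u1; elim=> [z|{}n t a b c k ab _ IH]; first by rewrite normr0.
have := fT a; have := u1 _ _ _ ab => ub fa.
suff : (`|f a * (u b - u a)| <= T%:Z * 1)%R by move: (_ * (_ - _))%R => z; lia.
by rewrite normrM; apply: ler_pM; rewrite ?normr_ge0.
Qed.

End WalkWord.

(** * The linear isoperimetric inequality for integrals *)

Section Stokes.
Variables (G : groupType) (L : Type) (X : set G) (H : L -> set G).
Hypothesis (XV : forall x, X x -> X x^-1) (HH : forall l, is_subgroup (H l)).
Hypothesis genX : generated (X `|` \bigcup_l H l) = setT.
Hypothesis (finX : finite_set X) (hyp : rel_hyperbolic H).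

Local Notation dst := (dist XV HH genX).

Definition lipschitz (f : G -> int) : Prop :=
  forall x y, (`|f x - f y| <= (dst x y)%:Z)%R.

Lemma fword_val_of_word (Z : set G) (w : seq (letter Z H)) :
  fword_val (of_word w) = word_val w.
Proof. by rewrite /fword_val /word_val big_map. Qed.

Lemma of_word_cat (Z : set G) (v w : seq (letter Z H)) :
  of_word (v ++ w) = of_word v ++ of_word w.
Proof. exact: map_cat. Qed.

(** The relative presentation given by hyperbolicity may use another generating
set [X0].  Each edge is therefore replaced by a word over [X0] of bounded
length, which changes the integral by a bounded amount per edge. *)
Theorem stokes : exists A : nat, forall f u, lipschitz f -> lipschitz u ->
  forall n x i, walk_integral X H f u n x x i -> (`|i| <= (A * n)%:Z)%R.
Proof.
case: hyp => X0 [Rel [finX0 finRel [[X0V genX0] presR] [C area]]].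
pose dist0 := dist X0V HH genX0.
have [N NX0] : exists N, forall x, X0 x -> (dst 1%g x <= N)%N.
  apply: finite_uniform finX0 _ _ => [m n x mn|x _]; last by exists (dst 1%g x).
  by move=> /leq_trans; apply.
have [rho0 rhoX] : exists rho, forall x, X x -> (dist0 1%g x <= rho)%N.
  apply: finite_uniform finX _ _ => [m n x mn|x _]; last by exists (dist0 1%g x).
  by move=> /leq_trans; apply.
have [r rR] : exists r, forall w, Rel w -> (size w <= r)%N.
  apply: finite_uniform finRel _ _ => [m n x mn|x _]; last by exists (size x).
  by move=> /leq_trans; apply.
have Rel1 w : Rel w -> fword_val w = 1 by move=> Rw; apply/presR; constructor.
pose K := maxn N 1; pose rho := maxn rho0 1.
(* Steps over [X0] and over the [H l] move by at most [K] in the metric defined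
   by [X]. *)
have lipK f : lipschitz f -> forall g (a : letter X0 H),
    (`|f (g * letter_val a)%g - f g| <= K%:Z)%R.
  move=> fL g a; apply: le_trans (fL _ _) _; rewrite lez_nat /K.
  rewrite distC -[X in dist _ _ _ X _]mulg1 distMl leq_max.
  case: a => [[x xP]|l h] /=; first by rewrite NX0 //; apply: set_mem.
  apply/orP; right; apply: (@dist_coset _ _ _ _ _ _ _ l 1); rewrite /coset /=.
    by rewrite mulVg; apply: subgroup1.
  by rewrite invg1 mul1g; apply: (@letter_valH _ _ X).
(* Conversely, [rho] letters over [X0] replace an edge labelled in [X]. *)
have stepW t x y : step X H t x y -> exists W : seq (letter X0 H),
    (size W <= rho)%N /\ x * word_val W = y.
  move=> xy; have xyr : (dist0 x y <= rho)%N.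
    case: t xy => [l [xy _]|xy] /=; rewrite leq_max.
      apply/orP; right; apply: (@dist_coset _ _ _ _ _ _ _ l x) => //.
      exact: coset_refl.
    by rewrite -[y](mulVKg x) -[X in dist0 X _]mulg1 /dist0 distMl rhoX.
  have [w [sw xw _]] := walk_word (dist_walk X0V HH genX0 x y).
  by exists w; rewrite sw.
pose B := (rho^2 * K^2)%N; pose D := (C * rho * (r^2 * K^2))%N.
exists (B + D)%N => f u fL uL n x i wi.
have [W [sW xW IW]] : exists W : seq (letter X0 H), [/\ (size W <= n * rho)%N,
    x * word_val W = x &
    (`|integral f u x (of_word W) - i| <= (n * B)%:Z)%R].
  move: wi; move: {2 4}x => y; elim=> [z|{}n t a b c k ab _ [W [sW bW IW]]].
    by exists [::]; rewrite word_val_nil mulg1 /= subrr.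
  have [V [sV aV]] := stepW _ _ _ ab.
  exists (V ++ W); rewrite size_cat word_val_cat mulgA aV bW; split=> //.
    by rewrite mulSn leq_add.
  rewrite of_word_cat integral_cat.
  rewrite fword_val_of_word aV.
  have [_] := integral_err HH (lipK _ fL) (lipK _ uL) a (of_word V).
  rewrite fword_val_of_word aV size_map => IV.
  have : ((size V)^2 * K^2 <= B)%N by rewrite leq_mul // leq_sqr.
  move: IV IW; move: (B) (_ ^ 2 * _)%N (f a * (u b - u a))%R => B' q z; lia.
have W1 : word_val W = 1 by apply: (@mulgI _ x); rewrite mulg1.
have [k [cp _] kC] := area _ W1.
have := conj_product_integral HH (lipK _ fL) (lipK _ uL) Rel1 rR cp x.
have : (k * (r^2 * K^2) <= D * n)%N.
  apply: leq_trans (_ : C * (n * rho) * (r^2 * K^2) <= _)%N; last first.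
    by rewrite /D; lia.
  by rewrite leq_mul2r (leq_trans kC) ?orbT // leq_mul2l sW orbT.
move: IW; lia.
Qed.

End Stokes.

(** * Stability of quasi-geodesics *)

Section Morse.
Variables (G : groupType) (L : Type) (X : set G) (H : L -> set G).
Hypothesis (XV : forall x, X x -> X x^-1) (HH : forall l, is_subgroup (H l)).
Hypothesis genX : generated (X `|` \bigcup_l H l) = setT.

Local Notation dst := (dist XV HH genX).

(** A path that remembers the kinds of its edges but not their letters.  The two
functions are only meaningful up to [plen]; prefixes and reversals are then
obtained without any manipulation of words. *)
Record tpath := TPath {
  plen : nat;
  pv : nat -> G;
  pt : nat -> option L;
  pstep : forall m, (m < plen)%N -> step X H (pt m) (pv m) (pv m.+1) }.

Implicit Types p q : tpath.

Definition quasi_geo (mu c : nat) p : Prop := forall m n, (m <= n <= plen p)%N ->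
  (n - m <= mu * dst (pv p m) (pv p n) + c)%N.

(** Because of the truncation, the integral along each of the two connecting
geodesics is at most [T * T]. *)
Fixpoint trunc_dist (T : nat) (s : seq G) (x : G) : nat :=
  if s is y :: s' then minn (dst x y) (trunc_dist T s' x) else T.

Lemma trunc_dist_lip T s : lipschitz XV HH genX (fun x => Posz (trunc_dist T s x)).
Proof.
move=> x y; elim: s => [|z s IHs] /=; first by rewrite subrr normr0.
by have := dist_tri XV HH genX y x z; have := dist_tri XV HH genX x y z;
  rewrite (distC XV HH genX y x); lia.
Qed.

Lemma trunc_dist_le T s x : (trunc_dist T s x <= T)%N.
Proof. by elim: s => //= y s; rewrite geq_min => ->; rewrite orbT. Qed.

Lemma trunc_dist0 T s x : x \in s -> trunc_dist T s x = 0%N.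
Proof.
elim: s => //= y s IHs; rewrite inE => /orP[/eqP<-|/IHs ->].
  by rewrite distxx min0n.
by rewrite minn0.
Qed.

Lemma trunc_dist_far T s x :
  (forall y, y \in s -> (T <= dst x y)%N) -> trunc_dist T s x = T.
Proof.
elim: s => //= y s IHs far; rewrite IHs => [|z zs]; last first.
  by apply: far; rewrite inE zs orbT.
by apply/minn_idPr/far; rewrite mem_head.
Qed.

Lemma dist_lip a : lipschitz XV HH genX (fun x => Posz (dst a x)).
Proof.
move=> x y; have := dist_tri XV HH genX x a y; have := dist_tri XV HH genX y a x.
by rewrite (distC XV HH genX y x); lia.
Qed.

Lemma lip_step f t x y : lipschitz XV HH genX f -> step X H t x y ->
  (`|f y - f x| <= 1)%R.
Proof.
by move=> /(_ y x) fL /(dist_step XV HH genX); rewrite distC in fL; lia.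
Qed.

Lemma path_walk ok p m n : (m <= n <= plen p)%N ->
  (forall j, (m <= j < n)%N -> ok (pt p j) (pv p j)) ->
  walk X H ok (n - m) (pv p m) (pv p n).
Proof.
move=> /andP[mn np] okp; apply: walk_segment => // j jmn; split; first exact: okp.
by apply: pstep; lia.
Qed.

Lemma path_dist p m n : (m <= n <= plen p)%N -> (dst (pv p m) (pv p n) <= n - m)%N.
Proof.
by move=> mn; apply: (dist_le XV HH genX (path_walk (ok := @anywhere _ _) mn _)).
Qed.

Lemma qgeo_dist mu c p m n : quasi_geo mu c p ->
  (m <= plen p)%N -> (n <= plen p)%N ->
  (n - m <= mu * dst (pv p m) (pv p n) + c)%N.
Proof.
move=> qp mp np; have [mn|nm] := leqP m n; first by apply: qp; rewrite mn.
by rewrite (eqP (ltnW nm : n - m == 0)%N).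
Qed.

(** The form vanishes on [p], in either direction.  One of the two differences
that make up the length is 0. *)
Lemma path_trunc p T (s := [seq pv p j | j <- iota 0 (plen p).+1])
    (u : G -> int) m n :
  (m <= plen p)%N -> (n <= plen p)%N ->
  walk_integral X H (fun x => Posz (trunc_dist T s x)) u (n - m + (m - n))
    (pv p m) (pv p n) 0%R.
Proof.
set f := fun x : G => _ => mp np.
have f0 j : (j <= plen p)%N -> f (pv p j) = 0%R.
  move=> jp; rewrite /f trunc_dist0 //; apply/mapP; exists j => //.
  by rewrite mem_iota.
have [mn|nm] := leqP m n.
  rewrite (eqP mn) addn0 -(mul0r (u (pv p n) - u (pv p m))%R).
  apply: (@wint_segment _ _ _ _ _ _ _ (pv p) (pt p)) => // j jmn.
    by apply: pstep; lia.
  by apply: f0; lia.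
rewrite (eqP (ltnW nm : n - m == 0)%N) add0n -(mul0r (u (pv p n) - u (pv p m))%R).
pose v j := pv p (n + m - j)%N.
have -> : pv p m = v n by rewrite /v addKn.
have -> : pv p n = v m by rewrite /v addnK.
apply: (@wint_segment _ _ _ _ _ _ _ v (fun j => pt p (n + m - j.+1)))
  => [|j jnm|j jnm].
- exact: ltnW.
- rewrite /v; apply: step_sym => //.
  have -> : (n + m - j = (n + m - j.+1).+1)%N by lia.
  by apply: pstep; lia.
- by apply: f0; lia.
Qed.

Hypothesis (finX : finite_set X) (hyp : rel_hyperbolic H).

(** Let [i1] and [i2] be the last index before [i] and the first index after [i]
where [p] is within [T] of [q].  The Stokes inequality, applied to the loop that
runs along [p] from [i1] to [i2] and returns along [q], bounds the distance
between these two points because [T] exceeds [2 * A * mu]. *)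
Theorem morse mu c k : exists D : nat, forall p q,
  quasi_geo mu c p -> quasi_geo mu c q ->
  (dst (pv p 0) (pv q 0) <= k)%N -> (dst (pv p (plen p)) (pv q (plen q)) <= k)%N ->
  forall i, (i <= plen p)%N ->
  exists2 j, (j <= plen q)%N & (dst (pv p i) (pv q j) <= D)%N.
Proof.
have [A stokesA] := stokes XV HH genX finX hyp.
pose T := (2 * A * mu + 1 + k)%N.
(* [d0] bounds the distance between the ends of an excursion: with slope
   [2 * A * mu] absorbed by [T], it collects the constant terms, namely
   [2 * T * T] from the two geodesics and [A] times the bounded part of the
   length of the loop. *)
pose d0 := (2 * (T * T) + A * (2 * T + 2 * mu * (2 * T) + 2 * c))%N.
exists (mu * d0 + c + T)%N => p q qp qq k0 k1 i ip.
pose near m := exists2 j, (j <= plen q)%N & (dst (pv p m) (pv q j) <= T)%N.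
have near0 : near 0%N by exists 0%N => //; rewrite (leq_trans k0) // leq_addl.
have near1 : near (plen p).
  by exists (plen q) => //; rewrite (leq_trans k1) // leq_addl.
have [i1 /andP[i1i /asboolP[j1 j1q d1]] max1] : exists2 i1,
    (i1 <= i)%N && `[< near i1 >] &
    forall m, (m <= i)%N && `[< near m >] -> (m <= i1)%N.
  have ex1 : exists m, (m <= i)%N && `[< near m >].
    by exists 0%N; apply/asboolP.
  have ub1 m : (m <= i)%N && `[< near m >] -> (m <= i)%N by case/andP.
  by case: (ex_maxnP ex1 ub1) => i1; exists i1.
have [i2 /and3P[ii2 i2p /asboolP[j2 j2q d2]] min2] : exists2 i2,
    [&& (i <= i2)%N, (i2 <= plen p)%N & `[< near i2 >]] &
    forall m, [&& (i <= m)%N, (m <= plen p)%N & `[< near m >]] -> (i2 <= m)%N.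
  have ex2 : exists m, [&& (i <= m)%N, (m <= plen p)%N & `[< near m >]].
    by exists (plen p); rewrite ip leqnn; apply/asboolP.
  by case: (ex_minnP ex2) => i2; exists i2.
have [i1E|i1_lt] := eqVneq i1 i.
  by exists j1 => //; rewrite -i1E (leq_trans d1) // leq_addl.
have [i2E|i2_gt] := eqVneq i2 i.
  by exists j2 => //; rewrite -i2E (leq_trans d2) // leq_addl.
pose s := [seq pv q j | j <- iota 0 (plen q).+1].
pose f x : int := Posz (trunc_dist T s x).
pose a := pv p i1; pose b := pv p i2.
pose u x : int := Posz (dst a x).
have far m j : (i1 < m < i2)%N -> (j <= plen q)%N -> (T < dst (pv p m) (pv q j))%N.
  move=> /andP[i1m mi2] jq; rewrite ltnNge; apply/negP => dmj.
  have nm : `[< near m >] by apply/asboolP; exists j.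
  have [mi|im] := leqP m i.
    by have := max1 m; rewrite mi nm => /(_ isT); rewrite leqNgt i1m.
  have := min2 m; rewrite (ltnW im) nm (leq_trans (ltnW mi2) i2p) => /(_ isT).
  by rewrite leqNgt mi2.
(* At the ends of the excursion the distance to [q] is at least [T] because the
   next vertex inside is farther than [T]. *)
have fT m : (i1 <= m <= i2)%N -> f (pv p m) = Posz T.
  move=> mi; congr (Posz _); apply: trunc_dist_far => y /mapP[j].
  rewrite mem_iota => jq ->; have jq' : (j <= plen q)%N by lia.
  have [e1|n1] := eqVneq m i1.
    have := far i1.+1 j; have := path_dist (p := p) (m := i1) (n := i1.+1).
    have := dist_tri XV HH genX (pv p i1) (pv p i1.+1) (pv q j).
    by rewrite e1 (distC XV HH genX (pv p i1.+1) (pv p i1)); lia.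
  have [e2|n2] := eqVneq m i2.
    have := far i2.-1 j; have := path_dist (p := p) (m := i2.-1) (n := i2).
    have := dist_tri XV HH genX (pv p i2) (pv p i2.-1) (pv q j).
    by rewrite e2; lia.
  by apply: ltnW; apply: far => //; lia.
have fL : lipschitz XV HH genX f by apply: trunc_dist_lip.
have uL : lipschitz XV HH genX u by apply: dist_lip.
have fB x : (`|f x| <= T%:Z)%R by have := trunc_dist_le T s x; rewrite /f; lia.
have uB t x y : step X H t x y -> (`|u y - u x| <= 1)%R by apply: lip_step.
have wp : walk_integral X H f u (i2 - i1) a b (T%:Z * (u b - u a))%R.
  apply: (@wint_segment _ _ _ _ _ _ _ (pv p) (pt p)) => [|m mi|//]; first by lia.
  by apply: pstep; lia.
have [z2 w2] := walk_wint f u (dist_walk XV HH genX b (pv q j2)).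
have [z1 w1] := walk_wint f u (dist_walk XV HH genX (pv q j1) a).
have wq := path_trunc T u j2q j1q.
have := stokesA f u fL uL _ _ _ (wint_cat (wint_cat (wint_cat wp w2) wq) w1).
have := wint_bound fB uB w2; have := wint_bound fB uB w1.
have := qgeo_dist qq j1q j2q; have := qgeo_dist qq j2q j1q.
rewrite (distC XV HH genX (pv q j1) a) (distC XV HH genX (pv q j2) (pv q j1)).
have := dist_tri XV HH genX a (pv q j1) (pv q j2).
have := dist_tri XV HH genX b a (pv q j2).
have := qp i1 i2; rewrite i2p (leq_trans i1i ii2) => /(_ isT).
have -> : u a = 0%R by rewrite /u distxx.
rewrite /u -/a -/b (distC XV HH genX (pv q j1) a).
move: d1 d2; rewrite -/a -/b; set da := dst a _; set db := dst b _.
set dab := dst a b; set dq := dst _ _ => d1 d2 hp t1 t2 q1 q2 b1 b2 st.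
have dab0 : (dab <= d0)%N.
  have J : (j1 - j2 + (j2 - j1) <= mu * (2 * T + dab) + c)%N.
    have : (mu * dst (pv q j1) (pv q j2) <= mu * (2 * T + dab))%N.
      by rewrite leq_mul2l; apply/orP; right; lia.
    by lia.
  have AN : (A * (i2 - i1 + db + (j1 - j2 + (j2 - j1)) + da) <=
             A * ((mu * dab + c) + T + (mu * (2 * T + dab) + c) + T))%N.
    by rewrite leq_mul2l; apply/orP; right; lia.
  have Tda : (T * da <= T * T)%N by rewrite leq_mul2l d1 orbT.
  have Tdb : (T * db <= T * T)%N by rewrite leq_mul2l d2 orbT.
  have Tdab : (T * dab = 2 * A * mu * dab + dab + k * dab)%N by rewrite /T; lia.
  have Td : (T * dab <= 2 * (T * T) +
      A * ((mu * dab + c) + T + (mu * (2 * T + dab) + c) + T))%N.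
    by move: st b1 b2 AN Tda Tdb; clear; move: (A * _)%N (A * _)%N; lia.
  by rewrite /d0; move: Td Tdab; move: (T) => S; clear; lia.
exists j1 => //; apply: leq_trans (dist_tri XV HH genX a _ _) _.
apply: leq_add d1; rewrite distC; apply: leq_trans (path_dist _) _; first by lia.
have : (mu * dab <= mu * d0)%N by rewrite leq_mul2l dab0 orbT.
lia.
Qed.

End Morse.

(** * Reversal, phase vertices, and connecting two quasi-geodesics *)

Section Penetration.
Variables (G : groupType) (L : Type) (X : set G) (H : L -> set G).
Hypothesis (XV : forall x, X x -> X x^-1) (HH : forall l, is_subgroup (H l)).
Hypothesis genX : generated (X `|` \bigcup_l H l) = setT.

Local Notation dst := (dist XV HH genX).
Local Notation tpath := (tpath X H).
Local Notation quasi_geo := (quasi_geo XV HH genX).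
Local Notation coset := (coset H).

Implicit Types p q : tpath.

Lemma rev_path_step p m : (m < plen p)%N ->
  step X H (pt p (plen p - m.+1)%N) (pv p (plen p - m)%N) (pv p (plen p - m.+1)%N).
Proof.
move=> mp; apply: step_sym => //.
have -> : (plen p - m = (plen p - m.+1).+1)%N by lia.
by apply: pstep; lia.
Qed.

Definition rev_path p : tpath :=
  @TPath _ _ _ _ (plen p) (fun m => pv p (plen p - m)%N)
         (fun m => pt p (plen p - m.+1)%N) (@rev_path_step p).

Lemma prefix_step p i (ip : (i <= plen p)%N) m : (m < i)%N ->
  step X H (pt p m) (pv p m) (pv p m.+1).
Proof. by move=> mi; apply: pstep; lia. Qed.

Definition prefix p i (ip : (i <= plen p)%N) : tpath :=
  @TPath _ _ _ _ i (pv p) (pt p) (@prefix_step p i ip).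

(** A vertex is interior to a component exactly when the edges on both sides are
[H l]-edges for the same [l]. *)
Definition phase p n : Prop := (n <= plen p)%N /\
  forall l, (0 < n < plen p)%N -> pt p n.-1 = Some l -> pt p n <> Some l.

(** All edges in between being [H l]-edges means that the two edges lie in the
same component. *)
Definition no_backtrack p : Prop := forall l m n, (m < n < plen p)%N ->
  pt p m = Some l -> pt p n = Some l -> H l ((pv p m)^-1 * pv p n) ->
  forall j, (m <= j <= n)%N -> pt p j = Some l.

Lemma qgeo_rev mu c p : quasi_geo mu c p -> quasi_geo mu c (rev_path p).
Proof.
move=> qp m n /= mn; rewrite distC.
by have := qp (plen p - n)%N (plen p - m)%N; lia.
Qed.

Lemma qgeo_prefix mu c p i (ip : (i <= plen p)%N) :
  quasi_geo mu c p -> quasi_geo mu c (prefix ip).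
Proof. by move=> qp m n /= mn; apply: qp; lia. Qed.

Lemma phase_rev p n : phase (rev_path p) n -> phase p (plen p - n)%N.
Proof.
move=> [/= np ph]; split=> [|l n_in tl tl']; first exact: leq_subr.
have n0 : (0 < n < plen p)%N by lia.
apply: (ph l n0); last by rewrite -tl; congr (pt p _); lia.
by rewrite -tl'; congr (pt p _); lia.
Qed.

Lemma pstep_coset l p m n : (m <= n <= plen p)%N ->
  (forall j, (m <= j < n)%N -> pt p j = Some l) ->
  H l ((pv p m)^-1 * pv p n).
Proof.
move=> /andP[mn]; rewrite -(subnKC mn).
elim: (n - m)%N => [|d IHd] np tl; first by rewrite addn0 mulVg; apply: subgroup1.
have st : step X H (Some l) (pv p (m + d)%N) (pv p (m + d.+1)%N).
  by rewrite -(tl (m + d)%N) ?addnS; [apply: pstep; lia|lia].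
apply: (coset_step HH st (g := pv p m)); apply: IHd => [|j jm]; first by lia.
by apply: tl; lia.
Qed.

(** The first vertex of the component through a non-phase vertex is phase and
lies in the same coset. *)
Lemma phase_near p j : (j <= plen p)%N ->
  exists2 n, phase p n & (dst (pv p j) (pv p n) <= 1)%N.
Proof.
move=> jp; have [[l [jin t1 t2]]|nl] := pselect (exists l,
    [/\ (0 < j < plen p)%N, pt p j.-1 = Some l & pt p j = Some l]); last first.
  exists j; last by rewrite distxx.
  by split=> // l jin t1 t2; apply: nl; exists l.
pose P m := (m <= j)%N && `[< forall x, (m <= x <= j)%N -> pt p x = Some l >].
have exP : exists m, P m.
  by exists j; rewrite /P leqnn; apply/asboolP => x xj; rewrite (_ : x = j) //; lia.
case: (ex_minnP exP) => n /andP[nj /asboolP tn] nmin; exists n; last first.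
  apply: (@dist_coset _ _ _ _ XV HH genX l (pv p n)); last exact: coset_refl.
  by apply: pstep_coset => [|x xin]; [rewrite nj|apply: tn; lia].
split=> [|l' nin]; first by lia.
rewrite (tn n) ?leqnn ?nj // => t' [ll']; move: t'; rewrite -ll' => t'.
have := nmin n.-1; rewrite /P; case: asboolP => [_|[]]; first by lia.
move=> x xin; have [->|xn] := eqVneq x n.-1; first by [].
by apply: tn; lia.
Qed.

Section LeftFrame.
Hypothesis (finX : finite_set X) (hyp : rel_hyperbolic H).

(** Only [X]-edges are allowed here, so that a connecting walk meets no coset of
any [H l] in an edge. *)
Definition start_close k p q : Prop :=
  exists2 n, (n <= k)%N & walk X H (@only_X G L) n (pv p 0) (pv q 0).

(** Far from the origins, [j1] comes from [morse] applied to the prefixes ending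
at [i] and [j]; this is what guarantees [j1 <= j].  The constant [N] is chosen
so large that the crossing is out of reach of the coset. *)
Lemma left_frame (mu c k E : nat) : exists B : nat, forall p q,
  quasi_geo mu c p -> quasi_geo mu c q -> start_close k p q ->
  forall i j, (i <= plen p)%N -> (j <= plen q)%N -> (dst (pv p i) (pv q j) <= E)%N ->
  forall l g z, coset l g z -> (dst (pv p i) z <= E)%N ->
  exists i1 j1 n, [/\ (i1 <= i <= i1 + B)%N, (j1 <= j <= j1 + B)%N, (n <= B)%N,
    walk X H (avoid l (coset l g)) n (pv p i1) (pv q j1) &
    (coset l g (pv q j1) -> j1 = 0%N)].
Proof.
have [D morseD] := morse XV HH genX finX hyp mu c (maxn k E).
(* [N] steps along a quasi-geodesic lead to a distance of more than
   [E + D + 1]: further from the coset than the length [D] of the crossing, by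
   one more step, so that its end point is not in the coset either. *)
have [N NE] : exists N, N = (mu * (E + D + 1) + c + 1)%N by eexists.
exists (N + k + D + mu * (k + D + N + E) + c)%N => p q qp qq [n0 n0k w0] i j ip jq.
move=> dij l g z gz diz; have [iN|Ni] := ltnP i N.
  exists 0%N, 0%N, n0; split=> //; first by lia.
  - have := qgeo_dist qq (leq0n _) jq; rewrite subn0 => /leq_trans; apply=> //=.
    rewrite add0n leq_add2r; apply: leq_trans (leq_addl _ _).
    rewrite leq_mul2l; apply/orP; right.
    have := dist_tri XV HH genX (pv p 0) (pv q 0) (pv q j).
    have := dist_tri XV HH genX (pv p i) (pv p 0) (pv q j).
    have := path_dist XV HH genX (p := p) (m := 0) (n := i).
    have := dist_le XV HH genX w0; rewrite (distC _ _ _ (pv q 0) (pv p 0)); lia.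
  - by lia.
  - exact: walk_only_X.
have [j1 j1j dij1] : exists2 j1, (j1 <= j)%N &
    (dst (pv p (i - N)%N) (pv q j1) <= D)%N.
  have := morseD (prefix ip) (prefix jq) (qgeo_prefix (ip := ip) qp).
  move=> /(_ (qgeo_prefix (ip := jq) qq) _ _ (i - N)%N); apply=> /=.
  - by apply: leq_trans (dist_le XV HH genX w0) _; rewrite leq_max n0k.
  - by rewrite leq_max dij orbT.
  - exact: leq_subr.
have di1 : (E + D + 1 < dst (pv p (i - N)%N) (pv p i))%N.
  have := qp (i - N)%N i; rewrite leq_subr ip => /(_ isT); rewrite subKn //.
  rewrite ltnNge => qN; apply/negP => dN; move: qN.
  have : (mu * dst (pv p (i - N)%N) (pv p i) <= mu * (E + D + 1))%N.
    by rewrite leq_mul2l dN orbT.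
  by lia.
have di1z := dist_tri XV HH genX z (pv p (i - N)%N) (pv p i).
rewrite (distC _ _ _ z) in di1z.
exists (i - N)%N, j1, (dst (pv p (i - N)%N) (pv q j1)); split.
- by lia.
- rewrite j1j /=.
  have := qgeo_dist qq (leq_trans j1j jq) jq.
  have : (mu * dst (pv q j1) (pv q j) <= mu * (k + D + N + E))%N.
    rewrite leq_mul2l; apply/orP; right.
    have := dist_tri XV HH genX (pv p (i - N)%N) (pv q j1) (pv q j).
    have := dist_tri XV HH genX (pv p i) (pv p (i - N)%N) (pv q j).
    have := path_dist XV HH genX (p := p) (m := i - N) (n := i).
    rewrite (distC _ _ _ (pv q j1) (pv p _)); lia.
  lia.
- by lia.
- by apply: walk_avoid gz _ (dist_walk _ _ _ _ _); lia.
- move=> gq; have := dist_coset XV HH genX gq gz.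
  have := dist_tri XV HH genX (pv q j1) (pv p (i - N)%N) z; lia.
Qed.

End LeftFrame.

End Penetration.

(** * Distances in a word metric *)

Section Within.
Variables (G : groupType) (Y : set G).
Implicit Types x y z : G.

Definition within n x y : Prop :=
  exists2 w, words_for Y (x^-1 * y) w & (size w <= n)%N.

Lemma within_refl x : within 0 x x.
Proof. by exists [::] => //; split=> //; rewrite big_nil mulVg. Qed.

Lemma within_le m n x y : (m <= n)%N -> within m x y -> within n x y.
Proof. by move=> mn [w wY wm]; exists w => //; apply: leq_trans mn. Qed.

Lemma within_trans m n x y z : within m x y -> within n y z -> within (m + n) x z.
Proof.
move=> [v [vY vxy] vm] [w [wY wyz] wn]; exists (v ++ w).
  split=> [a|]; first by rewrite mem_cat => /orP[/vY|/wY].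
  by rewrite big_cat /= vxy wyz mulgA mulgK.
by rewrite size_cat leq_add.
Qed.

Lemma within1 x y : Y (x^-1 * y) -> within 1 x y.
Proof.
move=> Yxy; exists [:: x^-1 * y] => //; split=> [a|].
  by rewrite inE => /eqP ->; left.
by rewrite big_cons big_nil mulg1.
Qed.

End Within.

(** * Bounded penetration for typed paths *)

Section Fellow.
Variables (G : groupType) (L : Type) (X : set G) (H : L -> set G).
Hypothesis (XV : forall x, X x -> X x^-1) (HH : forall l, is_subgroup (H l)).
Hypothesis genX : generated (X `|` \bigcup_l H l) = setT.
Hypothesis (finX : finite_set X) (hyp : rel_hyperbolic H).
Variables (Y : set G) (B0 : nat).
Hypothesis XY : X `<=` Y.
Hypothesis isolated_edge : forall l n x y, H l (x^-1 * y) ->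
  walk X H (avoid l (coset H l x)) n y x -> within Y (B0 * n.+1) x y.

Local Notation dst := (dist XV HH genX).
Local Notation tpath := (tpath X H).
Local Notation quasi_geo := (quasi_geo XV HH genX).
Local Notation coset := (coset H).
Local Notation within := (within Y).

Implicit Types p q : tpath.

(** Freeness to the right of a vertex is expressed on the reversed path. *)
Definition left_free l (C : set G) p i : Prop :=
  forall m, (m < i)%N -> pt p m = Some l -> ~ C (pv p m).

Lemma coset_eq l g x : coset l g x -> coset l g = coset l x.
Proof. by move=> gx; have := cosetMr HH g gx; rewrite mulVKg. Qed.

Lemma path_avoid l C p m n : (m <= n <= plen p)%N -> left_free l C p n ->
  walk X H (avoid l C) (n - m) (pv p m) (pv p n).
Proof. by move=> mn free; apply: path_walk => // j jmn; apply: free; lia. Qed.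

(** Close up with the frame on the left.  If [q] has an [H l]-edge in the coset
after the crossing, the loop is run only up to the first such edge, so that the
edge from [x] to the starting point of that edge is isolated.  This starting
point is a phase vertex, since the preceding edge of [q] is not an [H l]-edge,
or there is none. *)
Lemma left_loop (mu c k E : nat) : exists B : nat, forall p q,
  quasi_geo mu c p -> quasi_geo mu c q -> start_close k p q ->
  forall i j, (i <= plen p)%N -> (j <= plen q)%N -> (dst (pv p i) (pv q j) <= E)%N ->
  forall l g x y m n, coset l g x -> coset l g y -> (m <= E)%N -> (n <= E)%N ->
  walk X H (avoid l (coset l g)) m (pv p i) x ->
  walk X H (avoid l (coset l g)) n (pv q j) y ->
  left_free l (coset l g) p i ->
  within B x y \/
  exists t, [/\ (t < j)%N, pt q t = Some l, coset l g (pv q t), phase q t &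
                within B x (pv q t)].
Proof.
have [B frame] := left_frame XV HH genX finX hyp mu c k E.
exists (B0 * (3 * B + 2 * E).+1)%N => p q qp qq cl i j ip jq dij l g x y m n.
move=> gx gy mE nE wx wy pfree.
have dix := dist_le XV HH genX wx.
have [i1 [j1 [n1 [i1i j1j n1B w1 j10]]]] :=
  frame p q qp qq cl i j ip jq dij l g x gx (leq_trans dix mE).
have loop z b : (b <= B + E)%N -> coset l g z ->
    walk X H (avoid l (coset l g)) b (pv q j1) z ->
    within (B0 * (3 * B + 2 * E).+1) x z.
  move=> bB gz wz.
  apply: within_le (isolated_edge (l := l) (n := b + n1 + (i - i1) + m) _ _).
  - by rewrite leq_mul2l; apply/orP; right; lia.
  - exact/(cosetP HH _ gx).
  rewrite -(coset_eq gx); apply: walk_cat wx; apply: walk_cat; last first.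
    by apply: path_avoid pfree; lia.
  exact: walk_cat (walk_avoid_rev XV HH wz) (walk_avoid_rev XV HH w1).
have [[t0 [t0j t0q t0g]]|qfree] := pselect (exists t, [/\ (j1 <= t < j)%N,
    pt q t = Some l & coset l g (pv q t)]); last first.
  left; apply: (loop y (j - j1 + n)%N) => //; first by lia.
  apply: walk_cat wy; apply: path_walk => [|t tj tl gt]; first by lia.
  by apply: qfree; exists t.
right; pose P t := (j1 <= t < j)%N && `[< pt q t = Some l /\ coset l g (pv q t) >].
have exP : exists t, P t by exists t0; rewrite /P t0j; apply/asboolP.
case: (ex_minnP exP) => t /andP[tj /asboolP[tl gt]] tmin.
exists t; split=> //; first by lia.
  split=> [|l' tin]; first by lia.
  rewrite tl => t'l [ll']; rewrite -{l'}ll' in t'l.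
  have tE : t.-1.+1 = t by lia.
  have [tj1|tj1] := eqVneq t j1.
    by have := j10; rewrite -tj1 => /(_ gt); lia.
  have := tmin t.-1; rewrite /P; case: asboolP => [_|[]]; first by lia.
  have st : step X H (Some l) (pv q t.-1) (pv q t).
    by have := pstep (t := q) (m := t.-1); rewrite t'l tE; apply; lia.
  split=> //; exact: (coset_step HH (step_sym XV HH st) gt).
apply: (loop _ (t - j1)%N) => //; first by lia.
apply: path_walk => [|s sin sl gs]; first by lia.
by have := tmin s; rewrite /P; case: asboolP => [_|[]//]; lia.
Qed.

(** Reversal exchanges the origins and the termini. *)
Definition ends_close k p q :=
  start_close k p q /\ start_close k (rev_path XV HH p) (rev_path XV HH q).

Lemma rev_path_free l g p i : (i <= plen p)%N ->
  (forall m, (i <= m < plen p)%N -> pt p m = Some l -> ~ coset l g (pv p m)) ->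
  left_free l (coset l g) (rev_path XV HH p) (plen p - i).
Proof.
move=> ip free m mi /= tl gm; apply: (free (plen p - m.+1)%N _ tl); first by lia.
apply: (coset_step HH _ gm); rewrite -tl; apply: (rev_path_step XV HH); lia.
Qed.

(** The edge joining the two vertices is isolated in the left loop. *)
Lemma connected_starts (mu c k : nat) : exists B : nat, forall p q,
  quasi_geo mu c p -> quasi_geo mu c q -> start_close k p q ->
  forall i j l g, (i <= plen p)%N -> (j <= plen q)%N ->
  coset l g (pv p i) -> coset l g (pv q j) ->
  left_free l (coset l g) p i -> left_free l (coset l g) q j ->
  within B (pv p i) (pv q j).
Proof.
have [B loop] := left_loop mu c k 1.
exists B => p q qp qq cl i j l g ip jq gi gj fp fq.
have dij := dist_coset XV HH genX gi gj.
have [//|] := loop p q qp qq cl i j ip jq dij l g _ _ _ _ gi gj (leq0n _) (leq0n _)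
  (walk_nil _ _ _ _) (walk_nil _ _ _ _) fp.
by move=> [t [tj tl gt _ _]]; case: (fq t tj tl).
Qed.

Lemma connected_ends (mu c k : nat) : exists B : nat, forall p q,
  quasi_geo mu c p -> quasi_geo mu c q ->
  start_close k (rev_path XV HH p) (rev_path XV HH q) ->
  forall i j l g, (i <= plen p)%N -> (j <= plen q)%N ->
  coset l g (pv p i) -> coset l g (pv q j) ->
  (forall m, (i <= m < plen p)%N -> pt p m = Some l -> ~ coset l g (pv p m)) ->
  (forall m, (j <= m < plen q)%N -> pt q m = Some l -> ~ coset l g (pv q m)) ->
  within B (pv p i) (pv q j).
Proof.
have [B starts] := connected_starts mu c k.
exists B => p q qp qq cl i j l g ip jq gi gj fp fq.
have := starts _ _ (qgeo_rev qp) (qgeo_rev qq) cl (plen p - i)%N (plen q - j)%N l g.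
rewrite /= !subKn //; apply=> //; try exact: leq_subr; exact: rev_path_free.
Qed.

(** Otherwise, without backtracking, the vertex would be interior to an
[H l]-component. *)
Lemma phase_free p i l g : no_backtrack p -> phase p i ->
  left_free l (coset l g) p i \/
  left_free l (coset l g) (rev_path XV HH p) (plen p - i).
Proof.
move=> nb [ip ph].
have [|nf] := pselect (left_free l (coset l g) p i); first by left.
right; apply: rev_path_free => // m im tm gm; apply: nf => n ni tn gn.
have nbj := nb l n m _ tn tm _; case: (ph l _ (nbj _ _ i.-1 _) (nbj _ _ i _)).
all: try exact/(cosetP HH _ gn).
all: lia.
Qed.

(** Induction along a geodesic from the phase vertex [u] of [p] to a phase vertex
[w] of [q]: every edge either is short for the metric of [Y], or offers a phase
vertex of [q] at bounded distance from its starting point.  A geodesic meets the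
coset of one of its [H l]-edges in no other [H l]-edge, so both its parts may
be used in the loop. *)
Lemma phase_close (mu c k : nat) : exists B : nat, forall p q,
  quasi_geo mu c p -> quasi_geo mu c q -> no_backtrack p -> ends_close k p q ->
  forall i, phase p i -> exists2 t, phase q t & within B (pv p i) (pv q t).
Proof.
have [D morseD] := morse XV HH genX finX hyp mu c k.
(* One more than [D], to move from a vertex of [q] to a phase vertex. *)
have [B loop] := left_loop mu c k D.+1.
exists (D.+1 * B.+1)%N => p q qp qq nb [cl cr] i phi.
have [ip _] := phi.
have [j [jq phj dij]] : exists j, [/\ (j <= plen q)%N, phase q j &
    (dst (pv p i) (pv q j) <= D.+1)%N].
  have [||j0 j0q dij0] := morseD p q qp qq _ _ i ip.
  - by case: cl => n nk /(dist_le XV HH genX)/leq_trans; apply.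
  - case: cr => n nk /(dist_le XV HH genX)/=.
    by rewrite !subn0 => /leq_trans; apply.
  have [j phj dj] := phase_near XV HH genX j0q.
  exists j; split=> //; first by case: phj.
  by have := dist_tri XV HH genX (pv q j0) (pv p i) (pv q j); lia.
set u := pv p i in dij *; set w := pv q j in dij *.
pose d := dst u w.
suff main n z : walk X H (@anywhere _ _) n z w -> (dst u z + n = d)%N ->
    within ((d - n) * B.+1) u z ->
    exists2 t, phase q t & within (d * B.+1) u (pv q t).
  have [||t pht wt] := main d u (dist_walk _ _ _ _ _).
  - by rewrite distxx.
  - by rewrite subnn mul0n; apply: within_refl.
  by exists t => //; apply: within_le wt; rewrite leq_mul2r dij orbT.
(* The end point is generalized, as an index of the inductive predicate. *)
have [w' w'E] : exists w', w' = w by exists w.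
rewrite -{1}w'E => wk.
elim: wk w'E => {z n} [z -> _|n t z z' y _ zz' wk IH yw duz wz].
  by rewrite subn0 => wz; exists j.
have dz' : (dst u z' = dst u z + 1)%N.
  have := dist_tri XV HH genX z u z'; have := dist_tri XV HH genX z' u w.
  have := dist_le XV HH genX wk; have := dist_step XV HH genX zz'.
  by rewrite yw -/d; lia.
have nd : (n < d)%N by lia.
have dn : ((d - n) * B.+1 = (d - n.+1) * B.+1 + B.+1)%N.
  by rewrite -mulSnr; congr (_ * _)%N; lia.
have next : within B.+1 z z' ->
    exists2 t, phase q t & within (d * B.+1) u (pv q t).
  move=> wzz'; apply: IH => //; first by lia.
  by rewrite dn; apply: within_trans wz wzz'.
have found s : phase q s -> within B z (pv q s) ->
    exists2 t, phase q t & within (d * B.+1) u (pv q t).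
  move=> phs wzs; exists s => //; apply: within_le (within_trans wz wzs).
  by apply: leq_trans (_ : (d - n) * B.+1 <= _)%N; [lia|rewrite leq_mul2r; lia].
case: t zz' => [l|] zz'; last first.
  by apply: next; apply: (@within_le _ _ 1) => //; apply: within1; apply: XY.
have gz := coset_refl HH l z; have gz' := coset_step HH zz' gz.
have wuz : walk X H (avoid l (coset l z)) (dst u z) u z.
  by apply: walk_avoid gz' _ (dist_walk _ _ _ _ _); rewrite // dz'; lia.
have wwz' : walk X H (avoid l (coset l z)) n w z'.
  apply: (@walk_avoid _ _ _ _ XV HH genX _ _ _ _ _ _ gz); last first.
    by rewrite -yw; apply: walk_any_rev.
  by have := dist_tri XV HH genX z u w; rewrite (distC _ _ _ w) -/d; lia.
have [mE nE] : (dst u z <= D.+1)%N /\ (n <= D.+1)%N by lia.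
have [free|free] := phase_free l z nb phi.
  have [wB|[s [_ _ _ phs ws]]] :=
      loop p q qp qq cl i j ip jq dij l z z z' _ _ gz gz' mE nE wuz wwz' free.
    by apply: next; apply: within_le wB.
  exact: found phs ws.
have := loop _ _ (qgeo_rev qp) (qgeo_rev qq) cr (plen p - i)%N (plen q - j)%N
  (leq_subr _ _) (leq_subr _ _).
rewrite /= !subKn // => /(_ dij l z z z' _ _ gz gz' mE nE wuz wwz' free).
case=> [wB|[s [_ _ _ phs ws]]]; first by apply: next; apply: within_le wB.
exact: found (phase_rev phs) ws.
Qed.

(** The left frame at [i] and the right frame at [i'] are joined along [q], which
has no [H l]-edge in the coset.  The two crossings may reach [q] in either
order. *)
Lemma missed_coset_short (mu c k : nat) : exists B : nat, forall p q,
  quasi_geo mu c p -> quasi_geo mu c q -> ends_close k p q ->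
  forall i i' l g, (i <= i' <= plen p)%N ->
  coset l g (pv p i) -> coset l g (pv p i') ->
  left_free l (coset l g) p i ->
  (forall m, (i' <= m < plen p)%N -> pt p m = Some l -> ~ coset l g (pv p m)) ->
  left_free l (coset l g) q (plen q) ->
  within B (pv p i) (pv p i').
Proof.
have [D morseD] := morse XV HH genX finX hyp mu c k.
have [B frame] := left_frame XV HH genX finX hyp mu c k (D + 1).
pose N := (mu * (4 * B + 1) + c)%N.
exists (B0 * (4 * B + N).+1)%N => p q qp qq [cl cr] i i' l g ii' gi gi' fp fp' fq.
have Dp := morseD p q qp qq.
have {}Dp m : (m <= plen p)%N ->
    exists2 j, (j <= plen q)%N & (dst (pv p m) (pv q j) <= D + 1)%N.
  move=> mp; have [||j jq dj] := Dp _ _ m mp.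
  - by case: cl => n nk /(dist_le XV HH genX)/leq_trans; apply.
  - case: cr => n nk /(dist_le XV HH genX)/=.
    by rewrite !subn0 => /leq_trans; apply.
  by exists j => //; lia.
have ip : (i <= plen p)%N by lia.
have i'p : (i' <= plen p)%N by lia.
have [j jq dij] := Dp i ip; have [j' j'q dij'] := Dp i' i'p.
have d0 : (dst (pv p i) (pv p i) <= D + 1)%N by rewrite distxx.
have d0' : (dst (pv p i') (pv p i') <= D + 1)%N by rewrite distxx.
have [a [b [n [ai bj nB wab _]]]] := frame p q qp qq cl i j ip jq dij l g _ gi d0.
have := frame _ _ (qgeo_rev qp) (qgeo_rev qq) cr (plen p - i')%N (plen q - j')%N
  (leq_subr _ _) (leq_subr _ _).
rewrite /= !subKn // => /(_ dij' l g _ gi' d0').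
move=> [a' [b' [n' [a'i b'j n'B wab' _]]]].
set a1 := (plen p - a')%N in wab'; set b1 := (plen q - b')%N in wab'.
have wq : exists2 m, (m <= N)%N &
    walk X H (avoid l (coset l g)) m (pv q b1) (pv q b).
  have dq : (dst (pv q b) (pv q b1) <= 4 * B + 1)%N.
    have := dist_le XV HH genX wab; have := dist_le XV HH genX wab'.
    have := path_dist XV HH genX (p := p) (m := a) (n := i).
    have := path_dist XV HH genX (p := p) (m := i') (n := a1).
    have := dist_coset XV HH genX gi gi'.
    have := dist_tri XV HH genX (pv p a) (pv q b) (pv q b1).
    have := dist_tri XV HH genX (pv p i) (pv p a) (pv q b1).
    have := dist_tri XV HH genX (pv p i') (pv p i) (pv q b1).
    have := dist_tri XV HH genX (pv p a1) (pv p i') (pv q b1).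
    by rewrite (distC _ _ _ (pv q b) (pv p a)) /a1; lia.
  have bq : (b <= plen q)%N by lia.
  have b1q : (b1 <= plen q)%N by apply: leq_subr.
  have muN x : (x <= 4 * B + 1)%N -> (mu * x + c <= N)%N.
    by move=> xB; rewrite leq_add2r leq_mul2l xB orbT.
  have [bb1|b1b] := leqP b b1.
    exists (b1 - b)%N.
      by apply: leq_trans (muN _ dq); apply: qgeo_dist.
    apply: walk_avoid_rev => //; apply: path_walk => [|m mb]; first by lia.
    by apply: fq; lia.
  exists (b - b1)%N.
    by rewrite distC in dq; apply: leq_trans (muN _ dq); apply: qgeo_dist.
  by apply: path_walk => [|m mb]; [lia|apply: fq; lia].
have [m mN wqm] := wq.
apply: within_le (isolated_edge (l := l) (n := a1 - i' + n' + m + n + (i - a)) _ _).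
- by rewrite leq_mul2l; apply/orP; right; rewrite /a1; lia.
- exact/(cosetP HH _ gi).
rewrite -(coset_eq gi); apply: walk_cat; last by apply: path_avoid fp; lia.
apply: walk_cat (walk_avoid_rev XV HH wab).
apply: walk_cat wqm; apply: walk_cat wab'; apply: path_walk => [|s sin].
  by rewrite /a1; lia.
by apply: fp'; move: sin; rewrite /a1; lia.
Qed.

End Fellow.

(** * From Cayley paths to typed paths *)

Section Bridge.
Variables (R : realType) (G : groupType) (L : Type) (X : set G) (H : L -> set G).
Hypothesis (XV : forall x, X x -> X x^-1) (HH : forall l, is_subgroup (H l)).
Hypothesis genX : generated (X `|` \bigcup_l H l) = setT.

Local Notation dst := (dist XV HH genX).

Implicit Types p q : cayley_path X H.

Lemma within_word_dist (Y : set G) n x y :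
  within Y n x y -> (word_dist R Y x y <= (n%:R)%:E)%E.
Proof.
move=> [w wY wn]; apply: (@le_trans _ _ ((size w)%:R%:E)%E).
  by apply: ereal_inf_lbound; exists w.
by rewrite lee_fin ler_nat.
Qed.

Lemma word_length_lt (Y : set G) n g : (word_length R Y g < n%:R%:E)%E ->
  exists2 w, words_for Y g w & (size w < n)%N.
Proof.
by move=> /ereal_inf_lt[_ [w wY <-]]; rewrite lte_fin ltr_nat => wn; exists w.
Qed.

Lemma only_X_walk w x y : words_for X (x^-1 * y) w ->
  walk X H (@only_X G L) (size w) x y.
Proof.
move=> [wX wxy]; have -> : y = x * \prod_(a <- w) a by rewrite wxy mulVKg.
elim: w x {wxy} wX => [|a w IHw] x wX; first by rewrite big_nil mulg1; left.
rewrite big_cons mulgA; right with None (x * a) => //=.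
  rewrite mulKg; have [//|/XV] : X a \/ X a^-1 by apply: wX; rewrite mem_head.
  by rewrite invgK.
by apply: IHw => b bw; apply: wX; rewrite inE bw orbT.
Qed.

Lemma take_onth (T : Type) (s : seq T) n a :
  onth s n = Some a -> take n.+1 s = rcons (take n s) a.
Proof.
elim: s n => [|b s IHs] [|n] //=; first by case=> ->; rewrite take0.
by move=> /IHs <-.
Qed.

Definition edge_type p m : option L :=
  if onth (label p) m is Some a then ltype a else None.

Lemma vertex_step p m : (m < len p)%N ->
  step X H (edge_type p m) (vertex p m) (vertex p m.+1).
Proof.
rewrite /len /edge_type /vertex -onthTE; case sm: onth => [a|] // _.
rewrite (take_onth sm) -cats1 word_val_cat word_val_cons word_val_nil mulg1 mulgA.
exact: letter_step.
Qed.

Definition tpath_of p : tpath X H := TPath (@vertex_step p).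

Lemma edge_typeP l p m :
  edge_type p m = Some l <-> exists h, onth (label p) m = Some (LH X (l := l) h).
Proof.
rewrite /edge_type; split=> [|[h ->] //]; case: onth => // -[//|l' h] [ll'].
by case: _ / ll'; exists h.
Qed.

Lemma edge_type_lt l p m : edge_type p m = Some l -> (m < len p)%N.
Proof. by move=> /edge_typeP[h e]; rewrite -onthTE e. Qed.

Lemma H_labelledP l p s :
  H_labelled l p s <-> forall n, (s.1 <= n < s.2)%N -> edge_type p n = Some l.
Proof. by split=> lab n /lab /edge_typeP. Qed.

Lemma component_coset l p s m n : is_H_component l p s ->
  (s.1 <= m <= s.2)%N -> (s.1 <= n <= s.2)%N ->
  H l ((vertex p m)^-1 * vertex p n).
Proof.
move=> [/andP[s12 s2p] _ /H_labelledP lab _] ms ns.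
have st k : (s.1 <= k <= s.2)%N -> coset H l (vertex p s.1) (vertex p k).
  move=> ks; apply: (pstep_coset HH (p := tpath_of p)) => [|j jk] /=; first by lia.
  by apply: lab; lia.
exact/(cosetP HH _ (st m ms))/st.
Qed.

Lemma component_ex l p m : edge_type p m = Some l ->
  exists2 s, is_H_component l p s & (s.1 <= m < s.2)%N.
Proof.
move=> tm; have mp := edge_type_lt tm.
pose P a := (a <= m)%N && `[< forall j, (a <= j <= m)%N -> edge_type p j = Some l >].
have exP : exists a, P a.
  by exists m; rewrite /P leqnn; apply/asboolP => j jm; rewrite (_ : j = m) //; lia.
pose Q b := [&& (m < b)%N, (b <= len p)%N &
  `[< forall j, (m <= j < b)%N -> edge_type p j = Some l >]].
have exQ : exists b, Q b.
  exists m.+1; rewrite /Q leqnn mp; apply/asboolP => j jm.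
  by rewrite (_ : j = m) //; lia.
have ubQ b : Q b -> (b <= len p)%N by case/and3P.
case: (ex_minnP exP) => a /andP[am /asboolP ta] amin.
case: (ex_maxnP exQ ubQ) => b /and3P[mb bp /asboolP tb] bmax.
exists (a, b) => /=; last by lia.
split=> /=.
- by rewrite /is_subpath /=; lia.
- by lia.
- apply/H_labelledP => j /= jab; have [jm|mj] := leqP j m; first by apply: ta; lia.
  by apply: tb; lia.
- case=> t1 t2; rewrite /is_subpath /= => tp /H_labelledP /= lab t1a bt2.
  have at1 : (a <= t1)%N.
    apply: amin; rewrite /P; apply/andP; split; first by lia.
    by apply/asboolP => j jt; apply: lab; lia.
  have t2b : (t2 <= b)%N.
    apply: bmax; apply/and3P; split; [by lia|by lia|].
    by apply/asboolP => j jt; apply: lab; lia.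
  by congr (_, _); lia.
Qed.

Lemma component_extend l p s t : is_H_component l p s ->
  (t.1 <= s.1)%N -> (s.2 <= t.2 <= len p)%N ->
  (forall j, (t.1 <= j < t.2)%N -> edge_type p j = Some l) -> t = s.
Proof.
move=> [sp s12 _ smax] ts st lab; apply: smax; last by lia.
- by rewrite /is_subpath; move: sp; rewrite /is_subpath; lia.
- exact/H_labelledP.
- by [].
Qed.

(** The components through the two edges are connected, hence equal. *)
Lemma without_backtrackingP p : without_backtracking p -> no_backtrack (tpath_of p).
Proof.
move=> nb l m n /= mn tm tn mnH j jmn.
have [s sC sm] := component_ex tm; have [s' s'C s'n] := component_ex tn.
have [ss'|nss'] := pselect (s' = s).
  by have [_ _ /H_labelledP lab _] := sC; apply: lab; move: s'n; rewrite ss'; lia.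
have [_ /(_ s' s'C nss')] := nb l s sC; case.
exists (vertex p m) => v [] [k /= ks <-].
  by apply: (component_coset sC); lia.
apply/(cosetP HH _ (g := vertex p n) (x := vertex p m)).
  by have := subgroupV (HH l) mnH; rewrite invgM invgK.
by apply: (component_coset s'C); lia.
Qed.

Lemma phaseP p n : phase (tpath_of p) n <->
  (n <= len p)%N /\ forall l s, is_H_component l p s -> ~ (s.1 < n < s.2)%N.
Proof.
split=> -[np ph]; split=> //.
  move=> l s [sp _ /H_labelledP lab _] sn; move: sp; rewrite /is_subpath => sp.
  by apply: (ph l) => /=; [lia|apply: lab; lia|apply: lab; lia].
move=> l /= nin t1 t2; have [s sC sn] := component_ex t1.
apply: (ph l s sC); have [ns|] := ltnP n s.2; first by lia.
move=> sn2; have s2 : s.2 = n by lia.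
have [_ _ /H_labelledP lab _] := sC.
have := @component_extend l p s (s.1, n.+1) sC; rewrite s2 /=.
move=> ext; suff : (s.1, n.+1) = s by move/(congr1 snd) => /=; lia.
apply: ext => [//||j jn]; first by lia.
by have [->//|jn'] := eqVneq j n; apply: lab; lia.
Qed.

(** An earlier [H l]-edge in the coset would belong to the same component and
extend it to the left. *)
Lemma component_free_left l p s g :
  without_backtracking p -> is_H_component l p s ->
  coset H l g (vertex p s.1) -> left_free l (coset H l g) (tpath_of p) s.1.
Proof.
move=> /without_backtrackingP nb sC gs m ms /= tm gm.
have [sp s12 /H_labelledP lab _] := sC; move: sp; rewrite /is_subpath => sp.
have ts : edge_type p s.1 = Some l by apply: lab; lia.
have := nb l m s.1 _ tm ts => /= tms.
have := @component_extend l p s (m, s.2) sC => /= ext.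
suff : (m, s.2) = s by move/(congr1 fst) => /=; lia.
apply: ext => [||j jm]; [lia|lia|]; have [js|sj] := leqP j s.1.
  by apply: tms; [lia|apply/(cosetP HH _ gm)|lia].
by apply: lab; lia.
Qed.

Lemma component_free_right l p s g :
  without_backtracking p -> is_H_component l p s ->
  coset H l g (vertex p s.1) ->
  forall m, (s.2 <= m < len p)%N -> edge_type p m = Some l ->
  ~ coset H l g (vertex p m).
Proof.
move=> /without_backtrackingP nb sC gs m ms tm gm.
have [sp s12 /H_labelledP lab _] := sC; move: sp; rewrite /is_subpath => sp.
have ts : edge_type p s.1 = Some l by apply: lab; lia.
have := nb l s.1 m _ ts tm => /= tms.
have := @component_extend l p s (s.1, m.+1) sC => /= ext.
suff : (s.1, m.+1) = s by move/(congr1 snd) => /=; lia.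
apply: ext => [||j jm]; [lia|lia|].
by apply: tms; [lia|apply/(cosetP HH _ gs)|lia].
Qed.

Lemma cayley_dist_le x y : (cayley_dist R X H x y <= (dst x y)%:R%:E)%E.
Proof.
have [w [sw xw _]] := walk_word (dist_walk XV HH genX x y).
apply: ereal_inf_lbound; exists (CayleyPath x w); last by rewrite /len /= sw.
by split=> //; rewrite /terminus /vertex /len /= take_size.
Qed.

Lemma quasi_geodesicP (mu c : R) p : (0 <= mu)%R -> (0 <= c)%R ->
  quasi_geodesic mu c p ->
  quasi_geo XV HH genX (Num.bound mu) (Num.bound c) (tpath_of p).
Proof.
move=> mu0 c0 qp m n mn; rewrite -(ler_nat R).
have := qp (m, n) mn; rewrite /sub_start /sub_end /= => /le_trans qmn.
have {qmn} := qmn (mu%:E * (dst (vertex p m) (vertex p n))%:R%:E + c%:E)%E.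
rewrite leeD2r ?lee_wpmul2l ?lee_fin ?cayley_dist_le // => /(_ isT).
rewrite natrD natrM => /le_trans; apply; apply: lerD.
  by apply: ler_wpM2r => //; apply/ltW/archi_boundP.
exact/ltW/archi_boundP.
Qed.

Lemma k_similarP (k : R) p q : (0 <= k)%R -> k_similar k p q ->
  ends_close XV HH (Num.bound k) (tpath_of p) (tpath_of q).
Proof.
move=> k0; rewrite /k_similar ge_max => /andP[ks kt].
have bk : (k%:E < (Num.bound k)%:R%:E)%E by rewrite lte_fin; apply: archi_boundP.
have walkk x y : (word_dist R X x y <= k%:E)%E ->
    exists2 n, (n <= Num.bound k)%N & walk X H (@only_X G L) n x y.
  move=> xy; have [w wX wk] := word_length_lt (le_lt_trans xy bk).
  by exists (size w); [apply: ltnW|apply: only_X_walk].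
have v0 r : vertex r 0 = origin r by rewrite /vertex take0 word_val_nil mulg1.
split; rewrite /start_close /= ?subn0; last exact: walkk.
by rewrite !v0; apply: walkk.
Qed.

(** The edge followed by the walk is a cycle in which the edge is a component by
itself, connected to no other one. *)
Lemma isolated_edge_bound (M : R) (Omega : L -> set G) (l : L) n x y :
  isolated_components_bound X H M Omega ->
  H l (x^-1 * y) -> walk X H (avoid l (coset H l x)) n y x ->
  within (X `|` \bigcup_l Omega l) (Num.bound M * n.+1) x y.
Proof.
move=> [M0 _ _ Mbound] xy wyx; set Y := _ `|` _.
have [->|nxy] := pselect (x = y); first exact: within_le (within_refl _ _).
have [a [ta xa]] : exists a : letter X H, ltype a = Some l /\ x * letter_val a = y.
  exact: step_letter.
have [w [sw yw okw]] := walk_word wyx.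
pose q := CayleyPath x (a :: w).
have vq m : vertex q m.+1 = y * word_val (take m w).
  by rewrite /vertex /= word_val_cons mulgA xa.
have len_q : len q = n.+1 by rewrite /len /= sw.
have tq m : edge_type q m.+1 = Some l -> ~ coset H l x (vertex q m.+1).
  rewrite vq => /edge_typeP[h /= wm]; exact: (okw m _ wm).
have xyC : coset H l x (vertex q 1) by rewrite vq take0 word_val_nil mulg1.
have t0 : edge_type q 0 = Some l by [].
have only01 t : is_subpath q t -> H_labelled l q t -> t.1 = 0%N -> (0 < t.2)%N ->
    t = (0, 1)%N.
  case: t => t1 t2; rewrite /is_subpath /= => tp /H_labelledP /= lab t10 t20.
  rewrite t10; congr (_, _); have [//|t2n1] := eqVneq t2 1%N.
  by case: (tq 0%N) => //; apply: lab; lia.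
have sC : is_H_component l q (0, 1)%N.
  split=> //.
  - by apply/H_labelledP => j /= j1; rewrite (_ : j = 0%N) //; lia.
  - move=> t tp lab t1 t2; apply: only01 => //=; first by move: t1 => /=; lia.
have iso : H_isolated l q (0, 1)%N.
  split=> // t [tp t12 lab tmax] nt [b conn].
  have [t1|t1] := eqVneq t.1 0%N; first by apply: nt; apply: only01 => //; lia.
  have tE : t.1 = t.1.-1.+1 by lia.
  apply: (tq t.1.-1); rewrite -tE.
    by move/H_labelledP: lab; apply; lia.
  have b0 : coset H l b (vertex q 0) by apply: conn; left; exists 0%N.
  have b1 : coset H l b (vertex q t.1).
    by apply: conn; right; exists t.1 => //=; lia.
  have : H l ((vertex q 0)^-1 * vertex q t.1) by apply/(cosetP HH _ b0).
  by rewrite {1}/vertex /= word_val_nil mulg1.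
have [||_] := Mbound q l [:: (0, 1)%N] _ isT.
- by rewrite /is_cycle /terminus len_q vq -sw take_size yw.
- by move=> s; rewrite inE => /eqP ->.
rewrite big_seq1 len_q /sub_val /= word_val_cons take0 word_val_nil mulg1.
have -> : letter_val a = x^-1 * y by rewrite -xa mulKg.
move=> le_M; have [] := @word_length_lt (Omega l) (Num.bound M * n.+1) (x^-1 * y).
  apply: le_lt_trans le_M _; rewrite lte_fin natrM ltr_pM2r ?ltr0n //.
  exact/archi_boundP/ltW.
move=> v [vO vxy] vn; exists v; last exact: ltnW.
by split=> // b /vO[Ob|Ob]; [left|right]; right; exists l.
Qed.

End Bridge.

Theorem theorem2p14 (R : realType) (G : groupType) (L : Type)
  (H : L -> set G) (HH : forall l, is_subgroup (H l))
  (hyp : rel_hyperbolic H)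
  (X : set G) (finX : finite_set X) (genX : rel_generating X H)
  (M : R) (Omega : L -> set G)
  (hOmega : isolated_components_bound X H M Omega)
  (mu c k : R) (mu1 : (1 <= mu)%R) (c0 : (0 <= c)%R) (k0 : (0 <= k)%R) :
  let Y := X `|` \bigcup_l Omega l in
  exists2 eps : R, (0 < eps)%R &
    forall p q : cayley_path X H,
      quasi_geodesic mu c p -> quasi_geodesic mu c q ->
      without_backtracking p -> without_backtracking q ->
      k_similar k p q ->
      [/\ phase_vertices p `<=` nbhd_closed Y eps (phase_vertices q) /\
          phase_vertices q `<=` nbhd_closed Y eps (phase_vertices p),
          forall l (s : subpath), is_H_component l p s ->
            (eps%:E <= word_dist R Y (sub_start p s) (sub_end p s))%E ->
            exists2 t : subpath, is_H_component l q t & H_connected l p s q t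
        & forall l (s t : subpath),
            is_H_component l p s -> is_H_component l q t ->
            H_connected l p s q t ->
            (maxe (word_dist R Y (sub_start p s) (sub_start q t))
                  (word_dist R Y (sub_end p s) (sub_end q t)) <= eps%:E)%E].
Proof.
move=> Y; have [XV gX] := genX.
have XY : X `<=` Y by left.
have edgeY l n x y := @isolated_edge_bound R G L X H HH M Omega l n x y hOmega.
set mu' := Num.bound mu; set c' := Num.bound c; set k' := Num.bound k.
have [B1 phaseB] := phase_close XV HH gX finX hyp XY edgeY mu' c' k'.
have [B2 longB] := missed_coset_short XV HH gX finX hyp edgeY mu' c' k'.
have [B3 startB] := connected_starts XV HH gX finX hyp edgeY mu' c' k'.
have [B4 endB] := connected_ends XV HH gX finX hyp edgeY mu' c' k'.
(* The successor makes every bound strictly smaller than epsilon, as the second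
   claim requires. *)
pose N := (B1 + B2 + B3 + B4).+1.
have withinN n x y : (n < N)%N -> within Y n x y ->
    (word_dist R Y x y <= (N%:R)%:E)%E.
  by move=> nN xy; apply: within_word_dist; apply: within_le xy; apply: ltnW.
have mu0 : (0 <= mu)%R by apply: le_trans mu1.
exists (N%:R)%R => [|p q qp qq nbp nbq sim]; first by rewrite ltr0n.
have {}qp := quasi_geodesicP XV HH gX mu0 c0 qp.
have {}qq := quasi_geodesicP XV HH gX mu0 c0 qq.
have tnbp := without_backtrackingP HH nbp; have tnbq := without_backtrackingP HH nbq.
have clpq := k_similarP XV HH k0 sim.
have clqp : ends_close XV HH k' (tpath_of q) (tpath_of p).
  have sym x y : (exists2 n, (n <= k')%N & walk X H (@only_X G L) n x y) ->
      exists2 n, (n <= k')%N & walk X H (@only_X G L) n y x.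
    by case=> n nk w; exists n => //; apply: walk_rev w.
  by case: clpq => /sym ? /sym ?.
have sub p' q' : quasi_geo XV HH gX mu' c' (tpath_of p') ->
    quasi_geo XV HH gX mu' c' (tpath_of q') -> no_backtrack (tpath_of p') ->
    ends_close XV HH k' (tpath_of p') (tpath_of q') ->
    phase_vertices p' `<=` nbhd_closed Y (N%:R%R : R) (phase_vertices q').
  move=> qp' qq' nb cl _ [n nph <-].
  have [t tph wt] := phaseB _ _ qp' qq' nb cl n (proj2 (phaseP p' n) nph).
  exists (vertex q' t); first by exists t => //; apply/phaseP.
  by apply: (withinN B1) => //; rewrite /N; lia.
split.
- by split; apply: sub.
- move=> l s sC far; pose g := vertex p s.1.
  have [sp s12 lab _] := sC; move: (sp); rewrite /is_subpath => sp'.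
  have gs : coset H l g (vertex p s.1) by apply: coset_refl.
  have gs' : coset H l g (vertex p s.2) by apply: (component_coset HH sC); lia.
  have [qfree|] := pselect (left_free l (coset H l g) (tpath_of q) (len q)).
    have w := longB _ _ qp qq clpq s.1 s.2 l g sp' gs gs'
      (component_free_left HH nbp sC gs) (component_free_right HH nbp sC gs) qfree.
    have le_B2 := le_trans far (within_word_dist R w).
    by move: le_B2; rewrite lee_fin ler_nat /N; lia.
  move=> /existsNP[m /not_implyP[mq /not_implyP[tm /contrapT gm]]].
  have [t tC tm'] := component_ex tm; exists t => //; exists g => v [] [n nin <-].
    by apply: (component_coset HH sC) => //=; lia.
  apply/(cosetP HH _ gm)=> /=; apply: (component_coset HH tC) => //; lia.
- move=> l s t sC tC [a conn].
  have [sp s12 _ _] := sC; have [tp t12 _ _] := tC.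
  move: sp tp; rewrite /is_subpath => sp tp.
  have as_ n : (s.1 <= n <= s.2)%N -> coset H l a (vertex p n).
    by move=> sn; apply: conn; left; exists n.
  have at_ n : (t.1 <= n <= t.2)%N -> coset H l a (vertex q n).
    by move=> tn; apply: conn; right; exists n.
  have [as1 at1] : coset H l a (vertex p s.1) /\ coset H l a (vertex q t.1).
    by split; [apply: as_|apply: at_]; lia.
  have [as2 at2] : coset H l a (vertex p s.2) /\ coset H l a (vertex q t.2).
    by split; [apply: as_|apply: at_]; lia.
  rewrite ge_max; apply/andP; split.
    apply: (@withinN B3); first by rewrite /N; lia.
    apply: (startB (tpath_of p) (tpath_of q) qp qq clpq.1 s.1 t.1 l a) => //=; try lia.
      exact: component_free_left.
    exact: component_free_left.
  apply: (@withinN B4); first by rewrite /N; lia.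
  apply: (endB (tpath_of p) (tpath_of q) qp qq clpq.2 s.2 t.2 l a) => //=; try lia.
    exact: component_free_right.
  exact: component_free_right.
Qed.
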